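(* Let $r\ge2$ be an integer and, for $N\ge1$, let $G_N$ be the rooted $r$-tree of depth $N$, and $E_N=G_N\times\mathbb{Z}$. Then for all $\varepsilon,\delta>0$, $$\lim_{N\to\infty}\inf_{x\in E_N}P_x\big[|G_N|^{2(1-\delta)}\le\mathcal{T}_{G_N}\le|G_N|^2(\log|G_N|)^{4+\varepsilon}\big]=1.$$
   Context: The rooted $r$-tree of depth $N$ is the finite tree with a root in which every vertex at graph distance less than $N$ from the root has exactly $r$ children and vertices at distance $N$ have none. $|G|$ is the number of vertices of $G$. For a finite connected graph $G$, the cylinder $E=G\times\mathbb{Z}$ has the product graph structure: $(g,u)$ and $(g',u')$ are neighbors iff $g=g'$, $|u-u'|=1$ or $u=u'$ and $g,g'$ are neighbors in $G$. $P_x$, $x\in E$, is the law of the discrete-time simple random walk $(X_n)_{n\ge0}$ on $E$ from $x$ (uniform jumps to neighbors). A finite $S\subseteq E$ disconnects $E$ if for large $M$, $G\times[M,\infty)$ and $G\times(-\infty,-M]$ lie in two distinct connected components of $E\setminus S$; $\mathcal{T}_G=\inf\{n\ge0:\{X_0,\dots,X_n\}\text{ disconnects }E\}$. *)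

(* Defs.v *)
From HB Require Import structures.
From mathcomp Require Import all_boot all_order all_algebra finmap.
From mathcomp Require Import all_classical all_reals all_analysis.

Set Implicit Arguments.
Unset Strict Implicit.
Unset Printing Implicit Defensive.

Import Order.TTheory GRing.Theory Num.Theory.
Import numFieldNormedType.Exports.

Local Open Scope classical_set_scope.
Local Open Scope ring_scope.

(* Vertices are encoded by their addresses: the words of length at most N in  *)
(* the alphabet 'I_r. The root is the empty word, and the children of a word  *)
(* u of length less than N are the r words rcons u i.                         *)
Notation tree r N := (bseq_of N (ordinal r)).

(* measurableType requires inhabited carriers. *)
HB.instance Definition _ (n : nat) (T : choiceType) :=
  isPointed.Build (n.-bseq T) [bseq].
HB.instance Definition _ := isPointed.Build int 0.

Definition is_child (r N : nat) (u v : tree r N) : bool :=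
  [exists i : 'I_r, bseqval v == rcons (bseqval u) i].

Definition tree_adj (r N : nat) : rel (tree r N) :=
  fun u v => is_child u v || is_child v u.

(* Throughout, a finite graph G is given by its adjacency relation e on a     *)
(* finite type V of vertices.                                                 *)
Notation cylinder V := (V * int)%type.

Section Cylinder.
Variables (V : finType) (e : rel V).
Implicit Types (x y : cylinder V) (S C : set (cylinder V)).

Definition cyl_adj : rel (cylinder V) := fun x y =>
  ((x.1 == y.1) && (`|x.2 - y.2| == 1)) || ((x.2 == y.2) && e x.1 y.1).

(* The set of neighbors is finite, so fset_set is faithful here. *)
Definition cyl_deg x : nat := #|` fset_set [set y | cyl_adj x y]|.

Definition srw_step (R : realType) x y : R :=
  if cyl_adj x y then (cyl_deg x)%:R^-1 else 0.

(* The set of trajectories is nat -> cylinder V, and X_n is evaluation at n.  *)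
(* The law of the walk is characterized by its finite-dimensional marginals.  *)
Definition is_srw_law (R : realType) x
    (P : set (nat -> cylinder V) -> \bar R) : Prop :=
  forall (n : nat) (p : nat -> cylinder V),
    P [set X | forall i, (i <= n)%N -> X i = p i] =
    ((p 0%N == x)%:R * \prod_(i < n) srw_step R (p i) (p i.+1))%:E.

Definition linked_off S x y : Prop :=
  exists p : seq (cylinder V),
    [/\ path cyl_adj x p, last x p = y & forall z, z \in x :: p -> ~ S z].

Definition component_off S C : Prop :=
  exists2 x, ~ S x & C = [set y | linked_off S x y].

Definition disconnects S : Prop :=
  \forall M \near \oo, exists C1 C2 : set (cylinder V),
    [/\ component_off S C1, component_off S C2, C1 <> C2,
        [set x | M%:Z <= x.2] `<=` C1 & [set x | x.2 <= - M%:Z] `<=` C2].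

(* As an infimum in \bar R, this is +oo when the trajectory X never           *)
(* disconnects the cylinder.                                                  *)
Definition disconnection_time (R : realType) (X : nat -> cylinder V) : \bar R :=
  ereal_inf [set (n%:R)%:E | n in
    [set n | disconnects [set X k | k in [set k | (k <= n)%N]]]].

End Cylinder.

(* Trajectory space, with the sigma-algebra generated by the coordinates.     *)
Definition trajectories (V : pointedType) :=
  g_sigma_algebraType
    [set [set X : nat -> cylinder V | X ny.1 = ny.2]
       | ny in [set: nat * cylinder V]].

(* Main.v *)
(* Upper bound. The walk disconnects the cylinder once it has covered its     *)
(* starting level. For neighbors u and v, the expected number of visits to w  *)
(* before hitting v, starting from u, is at most deg w, by reversibility; so  *)
(* along a tree path the expected number of visits to the level before        *)
(* hitting a given vertex of it is O(N |G|), with exponential tails by        *)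
(* Khasminskii's lemma. Hence O(N^2 |G|) visits to the level cover it, and    *)
(* these are made by time |G|^2 (log |G|)^(4 + eps), since the number of      *)
(* visits to a level by time n is at least of order sqrt n.                   *)
(*                                                                            *)
(* Lower bound. Take the comb F of the words 0^j 1^k, j < q, k <= l, with l a *)
(* small multiple of N and q a large constant. A disconnecting range also     *)
(* disconnects F x Z, so at some height either q well separated levels of F,  *)
(* or the q lines above the tips 0^j 1^l within a window of height O(l), have *)
(* all been visited. These q sets are mutually hard to reach: from one, the   *)
(* expected number of visits to another by time |G|^(2 - 2 delta) is          *)
(* exponentially small in N, as an explicit supersolution shows. For q large  *)
(* the product of q - 1 such factors beats the number of heights.             *)
Require Import Defs.
From mathcomp Require Import all_boot all_order all_algebra finmap.
From mathcomp Require Import all_classical all_reals all_analysis.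
From mathcomp Require Import zify ring lra.
Import Order.TTheory GRing.Theory Num.Theory.
Import numFieldNormedType.Exports.
Local Open Scope classical_set_scope.
Local Open Scope ring_scope.
Set Implicit Arguments.
Unset Strict Implicit.
Unset Printing Implicit Defensive.

(** * Walks and Green functions *)

(** Everything is reduced to finitely many steps: [prob_prefix_le] bounds probabilities under the
    law by [expect], and [disconnection_time_prob] leaves two expectations to be made small,
    uniformly in the starting point.

    Upper bound: a covered level disconnects ([cover_disconnects]). The Green function bound
    [kgreen_from_neighbor_le], chained by [kgreen_path_le], shows that the mean number of visits to
    the level before a given vertex of it is hit is at most some M = O(N |G|). [expect_exp_visits]
    turns this mean into an exponential tail, so m of order N M visits leave some vertex unhit with
    small probability. By [expect_few_visits], these m visits are made within a large multiple of
    m^2 steps. Since m^2 is of order |G|^2 (log |G|)^4, the factor (log |G|)^eps absorbs all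
    constants.

    Lower bound: by [free_levels_not_disconnects], one unvisited level and one unvisited tip line of
    the comb in each window leave a passage. Visiting q sets that are hard to reach from one another
    costs a product of q - 1 small factors ([expect_hit_all]), each supplied by [green_bound]. The
    supersolution behind it decays like b per step in the tree away from the path to the target and
    like c per unit of height. Superharmonicity fails at the leaves, and the repair costs a term of
    order b^N s for s^2 steps. With s of order mu^N, mu = r^(1 - delta) < r, this is small for some
    b between 1/r and 1/mu; here delta > 0 is essential. *)

Section Walk.
Variables (R : realType) (T : eqType) (nb : T -> seq T).

Definition avg (f : T -> R) x := (\sum_(y <- nb x) f y) / (size (nb x))%:R.

(* [expect n x F] is the expectation of F over the first n steps of the walk  *)
(* from x; F is applied to the list of the n.+1 visited points.               *)
Fixpoint expect n x (F : seq T -> R) : R :=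
  if n is n'.+1 then avg (fun y => expect n' y (fun p => F (x :: p))) x
  else F [:: x].

(* Expected sum of s along the times 0, ..., n; [kgreen a] stops the sum when *)
(* the walk hits a, the value at a being excluded.                            *)
Fixpoint green (s : T -> R) n x : R :=
  s x + (if n is n'.+1 then avg (green s n') x else 0).

Fixpoint kgreen a (s : T -> R) n x : R :=
  if x == a then 0
  else s x + (if n is n'.+1 then avg (kgreen a s n') x else 0).

Lemma avg_le f g x : (forall y, y \in nb x -> f y <= g y) -> avg f x <= avg g x.
Proof.
move=> fg; rewrite /avg ler_wpM2r ?invr_ge0//.
by rewrite !big_seq; apply: ler_sum.
Qed.

Lemma avg_ext f g x : (forall y, y \in nb x -> f y = g y) -> avg f x = avg g x.
Proof. by move=> fg; rewrite /avg; congr (_ / _); apply: eq_big_seq. Qed.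

Lemma avgD f g x : avg (fun y => f y + g y) x = avg f x + avg g x.
Proof. by rewrite /avg big_split mulrDl. Qed.

Lemma avgZ k f x : avg (fun y => k * f y) x = k * avg f x.
Proof. by rewrite /avg -big_distrr mulrA. Qed.

Lemma avg_sum (I : Type) (r : seq I) (f : I -> T -> R) x :
  avg (fun y => \sum_(i <- r) f i y) x = \sum_(i <- r) avg (f i) x.
Proof. by rewrite /avg exchange_big big_distrl. Qed.

Lemma avg_ge0 f x : (forall y, 0 <= f y) -> 0 <= avg f x.
Proof. by move=> f0; rewrite /avg divr_ge0// sumr_ge0. Qed.

Hypothesis nb_neq0 : forall x, nb x != [::].

Lemma size_nb_gt0 x : (0 : R) < (size (nb x))%:R.
Proof. by rewrite ltr0n lt0n size_eq0 nb_neq0. Qed.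

Lemma avg_cst k x : avg (fun=> k) x = k.
Proof.
rewrite /avg big_const_seq count_predT iter_addr_0 -[X in X / _]mulr_natr mulfK//.
by rewrite gt_eqF// size_nb_gt0.
Qed.

Definition step_rel : rel T := fun x y => y \in nb x.

Lemma expect_le n x (F G : seq T -> R) :
  (forall p, path step_rel x p -> size p = n -> F (x :: p) <= G (x :: p)) ->
  expect n x F <= expect n x G.
Proof.
elim: n x F G => [|n IHn] x F G FG /=; first by apply: FG.
apply: avg_le => y yx; apply: IHn => p yp sp; apply: FG => /=.
  by rewrite /step_rel yx.
by rewrite sp.
Qed.

Lemma expectD n x F G :
  expect n x (fun p => F p + G p) = expect n x F + expect n x G.
Proof.
elim: n x F G => [//|n IHn] x F G /=.
by rewrite -avgD; apply: avg_ext => y _; apply: IHn.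
Qed.

Lemma expectZ n x k F : expect n x (fun p => k * F p) = k * expect n x F.
Proof.
elim: n x F => [//|n IHn] x F /=.
by rewrite -avgZ; apply: avg_ext => y _; apply: IHn.
Qed.

Lemma expect_cst n x k : expect n x (fun=> k) = k.
Proof.
elim: n x => [//|n IHn] x /=.
by rewrite -[RHS](avg_cst k x); apply: avg_ext => y _; apply: IHn.
Qed.

Lemma expect_sum (I : Type) (r : seq I) n x (F : I -> seq T -> R) :
  expect n x (fun p => \sum_(i <- r) F i p) = \sum_(i <- r) expect n x (F i).
Proof.
elim: r => [|i r IHr].
  rewrite big_nil -[RHS](expect_cst n x 0).
  by congr expect; apply/funext => p; rewrite big_nil.
rewrite big_cons -IHr -expectD.
by congr expect; apply/funext => p; rewrite big_cons.
Qed.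

Lemma green_ge0 s n x : (forall y, 0 <= s y) -> 0 <= green s n x.
Proof.
move=> s0; elim: n x => [|n IHn] x /=; first by rewrite addr0.
by rewrite addr_ge0// avg_ge0.
Qed.

Lemma green_mono s n m x :
  (forall y, 0 <= s y) -> (n <= m)%N -> green s n x <= green s m x.
Proof.
move=> s0; elim: n m x => [|n IHn] [|m] x //= nm.
  by rewrite lerD2l avg_ge0// => y; apply: green_ge0.
by rewrite lerD2l; apply: avg_le => y _; apply: IHn.
Qed.

Lemma green_sum (I : Type) (r : seq I) (s : I -> T -> R) n x :
  green (fun y => \sum_(i <- r) s i y) n x = \sum_(i <- r) green (s i) n x.
Proof.
elim: n x => [|n IHn] x /=.
  by rewrite addr0; apply: eq_bigr => i _; rewrite addr0.
rewrite big_split/= -avg_sum; congr (_ + _).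
by apply: avg_ext => y _; apply: IHn.
Qed.

Lemma green_le (s t : T -> R) n x :
  (forall y, s y <= t y) -> green s n x <= green t n x.
Proof.
move=> st; elim: n x => [|n IHn] x /=; first by rewrite !addr0.
by rewrite lerD//; apply: avg_le.
Qed.

Lemma greenZ k s n x : green (fun y => k * s y) n x = k * green s n x.
Proof.
elim: n x => [|n IHn] x /=; first by rewrite !addr0.
by rewrite mulrDr -avgZ; congr (_ + _); apply: avg_ext => y _; apply: IHn.
Qed.

(* The factor 1 + l is a killing rate, without which a recurrent walk has no  *)
(* nontrivial nonnegative supersolution.                                      *)
Lemma green_super s phi l n x :
  0 <= l -> (forall y, 0 <= phi y) -> (forall y, 0 <= s y) ->
  (forall y, s y + avg phi y <= (1 + l) * phi y) ->
  green s n x <= (1 + l) ^+ n.+1 * phi x.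
Proof.
move=> l0 phi0 s0 sup; have l1 : 1 <= 1 + l by rewrite lerDl.
elim: n x => [|n IHn] x /=.
  rewrite addr0 expr1; apply: le_trans (sup x).
  by rewrite lerDl avg_ge0.
have H : avg (green s n) x <= (1 + l) ^+ n.+1 * avg phi x.
  by rewrite -avgZ; apply: avg_le => y _.
apply: (le_trans (lerD (lexx _) H)).
rewrite [_ ^+ n.+2]exprSr -mulrA; apply: (@le_trans _ _ ((1 + l) ^+ n.+1 * (s x + avg phi x))).
  by rewrite mulrDr lerD2r ler_peMl// exprn_ege1.
by rewrite ler_wpM2l// exprn_ge0// (le_trans ler01).
Qed.

(** At the first visit to one of the sets, that set is dropped from the list and the walk starts
    afresh at one of its points. From there each remaining set is reached with probability at most
    its expected number of visits, hence at most rho. The factorial counts the orders in which the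
    remaining sets can come. *)
Lemma expect_hit_all (A : nat -> pred T) (rho : R) (m : nat) (I : seq nat) n x :
  0 <= rho ->
  (forall i j y, i \in I -> j \in I -> i != j -> A i y ->
     green (fun z => (A j z)%:R) m y <= rho) ->
  uniq I -> (n <= m)%N ->
  expect n x (fun p => (all (fun i => has (A i) p) I)%:R) <=
    if I is _ :: I' then
      (\sum_(i <- I) green (fun z => (A i z)%:R) n x) *
        ((size I')`!%:R * rho ^+ size I')
    else 1.
Proof.
move=> rho0; have gA0 i y : 0 <= (A i y)%:R :> R by case: (A i y).
move: {2}(size I) (erefl (size I)) => k; elim: k I n x => [|k IHk] I n x.
  by move/size0nil->; rewrite expect_cst.
move=> sI HA uI nm.
have eI : exists i0 I', I = i0 :: I' by case: I sI {HA uI} => // i0 I'; exists i0, I'.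
case: eI => i0 [I' eI]; rewrite {-1}eI -eI.
have sI' : size I' = k by move: sI; rewrite eI => -[].
rewrite sI'; set c := _ * rho ^+ k.
have c0 : 0 <= c by rewrite /c mulr_ge0// exprn_ge0.
(* If the walk starts inside some [A i], the sum of Green functions is at least 1 and the other k
   sets suffice: for k > 0 the induction hypothesis gives k rho times (k - 1)! rho^(k - 1). *)
have hit_now x' n' : (n' <= m)%N -> has (A^~ x') I ->
    expect n' x' (fun p => (all (fun i => has (A i) p) I)%:R) <=
      (\sum_(i <- I) green (fun z => (A i z)%:R) n' x') * c.
  move=> nm' /hasP[i iI Aix].
  have g1 : 1 <= \sum_(i <- I) green (fun z => (A i z)%:R) n' x'.
    rewrite (big_rem i iI)/= -[1]addr0 lerD//.
      by case: (n') => [|n''] /=; rewrite Aix ?addr0// lerDl avg_ge0// => y; rewrite green_ge0.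
    by rewrite sumr_ge0// => j _; rewrite green_ge0.
  apply: (@le_trans _ _ c); last by rewrite ler_peMl.
  have uI' : uniq (rem i I) by rewrite rem_uniq.
  have HA' i1 j y : i1 \in rem i I -> j \in rem i I -> i1 != j -> A i1 y ->
     green (fun z => (A j z)%:R) m y <= rho.
    by move=> /mem_rem i1I /mem_rem jI; apply: HA.
  have srem : size (rem i I) = k by rewrite size_rem// sI.
  have := IHk (rem i I) n' x' srem HA' uI' nm'.
  set e1 := expect _ _ _; set e2 := expect _ _ _ => He1.
  have : e2 <= e1.
    apply: expect_le => p _ _; rewrite ler_nat; case E : (all _ I) => //.
    rewrite (_ : all _ (rem i I))//.
    by apply/allP => j /mem_rem; apply: (allP E).
  move/le_trans; apply; apply: (le_trans He1).
  case erem : (rem i I) srem => [|j0 J] /=.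
    by move=> sJ; rewrite /c -sJ fact0 expr0 mul1r.
  move=> sJ; rewrite /c -sJ factS exprS natrM.
  rewrite [X in _ <= X](_ : _ = (size J).+1%:R * rho * ((size J)`!%:R * rho ^+ size J)); last by ring.
  rewrite ler_wpM2r// ?mulr_ge0// ?exprn_ge0//.
  rewrite -[(size J).+1]/(size (j0 :: J)) -erem.
  rewrite -sum1_size natr_sum big_distrl/= !big_seq.
  apply: ler_sum => j jrem; rewrite mul1r.
  have ij : i != j by apply/eqP => eij; move: jrem; rewrite -eij mem_rem_uniqF.
  by apply: le_trans (HA i j x' iI (mem_rem jrem) ij Aix); apply: green_mono.
elim: n x nm => [|n IHn] x nm.
  have [hx|hx] := boolP (has (A^~ x) I); first exact: hit_now.
  apply: (@le_trans _ _ 0); last first.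
    by apply: mulr_ge0 => //; apply: sumr_ge0 => i _; apply: green_ge0.
  by move: hx; rewrite /= eI/= orbF negb_or => /andP[/negbTE-> _].
have [hx|hx] := boolP (has (A^~ x) I); first exact: hit_now.
have -> : expect n.+1 x (fun p => (all (fun i => has (A i) p) I)%:R) =
    avg (fun y => expect n y (fun p => (all (fun i => has (A i) p) I)%:R)) x.
  apply: avg_ext => y _; congr expect; apply/funext => p; congr (_%:R).
  congr nat_of_bool; apply: eq_in_all => i iI /=.
  by move/hasPn : hx => /(_ i iI)/negbTE->.
apply: (@le_trans _ _ (avg (fun y => c * \sum_(i <- I) green (fun z => (A i z)%:R) n y) x)).
  by apply: avg_le => y _; rewrite mulrC; apply: IHn; apply: ltnW.
rewrite avgZ mulrC ler_wpM2r// avg_sum big_seq [leRHS]big_seq.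
by apply: ler_sum => i iI /=; rewrite lerDr.
Qed.

End Walk.

(** * Killed walks *)

Section Killed.
Variables (R : realType) (T : eqType) (nb : T -> seq T).
Hypothesis nb_neq0 : forall x, nb x != [::].
Implicit Types (a u v w x : T) (s : T -> R).

Local Notation avg := (@avg R T nb).
Local Notation kgreen := (@kgreen R T nb).
Local Notation deg x := ((size (nb x))%:R : R).

Lemma kgreen_at a s n : kgreen a s n a = 0.
Proof. by case: n => [|n] /=; rewrite eqxx. Qed.

Lemma kgreen_ge0 a s n x : (forall y, 0 <= s y) -> 0 <= kgreen a s n x.
Proof.
move=> s0; elim: n x => [|n IHn] x /=; case: eqP => // _.
  by rewrite addr0.
by rewrite addr_ge0// avg_ge0.
Qed.

Lemma kgreen_mono a s n x :
  (forall y, 0 <= s y) -> kgreen a s n x <= kgreen a s n.+1 x.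
Proof.
move=> s0; elim: n x => [|n IHn] x.
  by rewrite /=; case: eqP => // _; rewrite lerD2l; apply: avg_ge0 => y; exact: (kgreen_ge0 a 0 y s0).
rewrite [leRHS]/= [leLHS]/=; case: eqP => // _.
by rewrite lerD2l; apply: avg_le => y _; apply: IHn.
Qed.

Lemma kgreen_sum (I : Type) (r : seq I) (s : I -> T -> R) a n x :
  kgreen a (fun y => \sum_(i <- r) s i y) n x = \sum_(i <- r) kgreen a (s i) n x.
Proof.
elim: n x => [|n IHn] x /=; case: eqP => _; rewrite ?addr0.
- by rewrite big1.
- by apply: eq_bigr => i _; rewrite addr0.
- by rewrite big1.
- rewrite big_split/= -avg_sum; congr (_ + _).
  by apply: avg_ext => y _; apply: IHn.
Qed.

(** Visits made before hitting a are made either before hitting v, or afterwards by a walk that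
    starts afresh from v. *)
Lemma kgreen_triangle a v s n x : (forall y, 0 <= s y) ->
  kgreen a s n x <= kgreen v s n x + kgreen a s n v.
Proof.
move=> s0; elim: n x => [|n IHn] x.
  have [->|xv] := eqVneq x v; first by rewrite kgreen_at add0r.
  rewrite -[leLHS]addr0 lerD ?kgreen_ge0// /= (negbTE xv).
  by case: eqP => // _; rewrite addr0.
have [->|xv] := eqVneq x v; first by rewrite kgreen_at add0r.
have [->|xa] := eqVneq x a; first by rewrite kgreen_at addr_ge0// kgreen_ge0.
rewrite [kgreen a s n.+1 x]/= [kgreen v s n.+1 x]/= (negbTE xv) (negbTE xa) -addrA lerD2l.
apply: (@le_trans _ _ (avg (fun y => kgreen v s n y + kgreen a s n v) x)).
  by apply: avg_le => y _; apply: IHn.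
by rewrite avgD avg_cst// lerD2l kgreen_mono.
Qed.

Hypothesis nb_uniq : forall x, uniq (nb x).
Hypothesis nb_sym : forall x y, (y \in nb x) = (x \in nb y).

Lemma deg_gt0 x : 0 < deg x. Proof. exact: size_nb_gt0. Qed.

Lemma deg_neq0 x : deg x != 0. Proof. by rewrite gt_eqF ?deg_gt0. Qed.

(* At each visit to u the walk is killed at the next step with probability at *)
(* least 1 / deg u, so the number of visits is dominated by a geometric law.  *)
Lemma kgreen_neighbor_le v u n w : v \in nb u ->
  kgreen v (fun y => (y == u)%:R) n w <= if w == v then 0 else deg u.
Proof.
move=> vu; have d1 : 1 <= deg u by rewrite ler1n lt0n size_eq0.
elim: n w => [|n IHn] w /=; case: eqP => // /eqP wv.
  by rewrite addr0 (le_trans _ d1)// lern1 leq_b1.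
apply: (@le_trans _ _ ((w == u)%:R + avg (fun y => if y == v then 0 else deg u) w)).
  by rewrite lerD2l; apply: avg_le => y _; apply: IHn.
have [->|wu] := eqVneq w u; last first.
  rewrite add0r -[leRHS](avg_cst nb_neq0 (deg u) w).
  by apply: avg_le => y _; case: ifP.
rewrite /avg (bigD1_seq v)//= eqxx add0r.
rewrite (eq_bigr (fun=> deg u)); last by move=> y /negbTE->.
rewrite -big_filter big_const_seq count_predT iter_addr_0.
rewrite -rem_filter// size_rem//.
rewrite -[X in X / _]mulr_natr mulrAC mulfV ?deg_neq0// mul1r.
by rewrite nat1r prednK// lt0n size_eq0.
Qed.

(** Probability of going from x to w in t steps while avoiding v, divided by deg w: the transition
    density of the killed walk with respect to its reversible measure, hence symmetric in x and
    w. *)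
Fixpoint kker v t x w : R :=
  if (x == v) || (w == v) then 0 else
  if t is t'.+1 then (\sum_(y <- nb x) kker v t' y w) / deg x
  else (x == w)%:R / deg w.

Lemma kker_killl v t w : kker v t v w = 0.
Proof. by case: t => [|t] /=; rewrite eqxx. Qed.

Lemma kker_killr v t x : kker v t x v = 0.
Proof. by case: t => [|t] /=; rewrite eqxx orbT. Qed.

Lemma kker_left v t x w : x != v ->
  kker v t.+1 x w = (\sum_(y <- nb x) kker v t y w) / deg x.
Proof.
move=> /negbTE xv; rewrite /= xv /=; case: eqP => // ->.
by rewrite big1 ?mul0r// => y _; rewrite kker_killr.
Qed.

(** The definition unfolds the first step of the walk, this lemma the last one, by symmetry of the
    neighbor relation. Matching the two recursions gives [kker_sym]. *)
Lemma kker_right v t x w : w != v ->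
  kker v t.+1 x w = (\sum_(y <- nb w) kker v t x y) / deg w.
Proof.
have pick (r : seq T) (F : T -> R) z : uniq r ->
    \sum_(y <- r) (y == z)%:R * F y = (z \in r)%:R * F z.
  move=> ur; have [zr|zr] := boolP (z \in r).
    rewrite (bigD1_seq z)//= eqxx big1 ?addr0// => y /negbTE->.
    by rewrite mul0r.
  rewrite mul0r big1_seq// => y /andP[_ yr].
  by case: eqP yr zr => [->->//|_ _ _]; rewrite mul0r.
elim: t x w => [|t IHt] x w wv.
  have [->|xv] := eqVneq x v.
    by rewrite kker_killl big1 ?mul0r// => y _; rewrite kker_killl.
  rewrite kker_left// [in LHS](eq_bigr (fun y => (y == w)%:R * (deg w)^-1)).
    rewrite pick// [in RHS](eq_bigr (fun y => (y == x)%:R * (deg x)^-1)).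
      by rewrite pick// (nb_sym x w) mulrAC.
    move=> y _ /=; rewrite (negbTE xv)/=; have [->|yx] := eqVneq y x.
      by rewrite (negbTE xv) mul1r.
    by rewrite !mul0r; case: ifP.
  move=> y _ /=; rewrite (negbTE wv) orbF; have [->|yw] := eqVneq y w.
    by rewrite (negbTE wv).
  by rewrite !mul0r; case: ifP.
have [->|xv] := eqVneq x v.
  by rewrite kker_killl big1 ?mul0r// => y _; rewrite kker_killl.
rewrite kker_left// (eq_bigr _ (fun y _ => IHt y w wv)).
rewrite [in RHS](eq_bigr _ (fun y _ => kker_left t y xv)).
by rewrite -!big_distrl/= exchange_big/= mulrAC.
Qed.

Lemma kker_sym v t x w : kker v t x w = kker v t w x.
Proof.
elim: t x w => [|t IHt] x w.
  rewrite /= orbC; case: ifP => // _.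
  by have [->//|xw] := eqVneq x w; rewrite !mul0r.
have [->|xv] := eqVneq x v; first by rewrite kker_killl kker_killr.
rewrite kker_left// kker_right//; congr (_ / _).
by apply: eq_bigr => y _.
Qed.

Lemma kgreen_kker v w n x : kgreen v (fun y => (y == w)%:R) n x =
  (if w == v then (x != v)%:R * kgreen v (fun y => (y == w)%:R) n x
   else deg w * \sum_(t < n.+1) kker v t x w).
Proof.
have [wv|wv] := eqVneq w v.
  by have [->|xv] := eqVneq x v; rewrite ?mul1r// kgreen_at mulr0.
elim: n x => [|n IHn] x.
  rewrite big_ord1 /= (negbTE wv) orbF; case: eqP; first by rewrite mulr0.
  by rewrite addr0 mulrCA mulfV ?mulr1// deg_neq0.
have [->|xv] := eqVneq x v.
  by rewrite kgreen_at big1 ?mulr0// => t _; rewrite kker_killl.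
rewrite [LHS]/= (negbTE xv) big_ord_recl mulrDr; congr (_ + _).
  by rewrite /= (negbTE xv) (negbTE wv) mulrCA mulfV ?mulr1// deg_neq0.
rewrite (avg_ext (fun y _ => IHn y)) avgZ; congr (_ * _).
rewrite avg_sum; apply: eq_bigr => t _.
by rewrite lift0 kker_left.
Qed.

(* Reversibility turns the geometric bound on the visits to u, killed at its  *)
(* neighbor v, into a bound on the visits to an arbitrary w starting from u.  *)
Lemma kgreen_from_neighbor_le v u n w : v \in nb u ->
  kgreen v (fun y => (y == w)%:R) n u <= deg w.
Proof.
move=> vu; have [->|wv] := eqVneq w v.
  apply: le_trans (_ : 0 <= _); last by rewrite ltW// deg_gt0.
  suff H : forall n x, kgreen v (fun y => (y == v)%:R) n x <= 0 by apply: H.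
  elim=> [|k IHk] x /=; case: eqP => // _; rewrite ?addr0//.
  rewrite add0r -(avg_cst nb_neq0 0 x).
  by apply: avg_le => y _.
have [->|uv] := eqVneq u v; first by rewrite kgreen_at ltW// deg_gt0.
rewrite kgreen_kker (negbTE wv) -[leRHS]mulr1 ler_wpM2l//.
under eq_bigr do rewrite kker_sym.
have := kgreen_neighbor_le n w vu.
rewrite kgreen_kker (negbTE uv) (negbTE wv).
by rewrite -[X in _ <= X -> _]mulr1 ler_pM2l// deg_gt0.
Qed.

(** By [kgreen_triangle] the target is approached one edge at a time, and each edge costs one Green
    function killed at a neighbor of its starting point. *)
Lemma kgreen_path_le (L : seq T) a p n x :
  path (fun u v => v \in nb u) x p -> last x p = a ->
  kgreen a (fun y => \sum_(w <- L) (y == w)%:R) n x <=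
    (size p)%:R * \sum_(w <- L) deg w.
Proof.
have s0 y : 0 <= \sum_(w <- L) (y == w)%:R :> R by apply: sumr_ge0.
elim: p x => [|y p IHp] x /=; first by move=> _ ->; rewrite kgreen_at mul0r.
case/andP => yx yp lp.
apply: (le_trans (kgreen_triangle a y n x s0)).
rewrite -natr1 mulrDl mul1r addrC lerD ?IHp// kgreen_sum.
by apply: ler_sum => w _; apply: kgreen_from_neighbor_le.
Qed.

(* Khasminskii's lemma, in the form of the supersolution 1 + kgreen / M.      *)
Lemma expect_exp_visits (L : pred T) a (M : R) n x : 1 <= M ->
  (forall k y, L y -> kgreen a (fun z => (L z)%:R) k y <= M) ->
  expect nb n x (fun p => (1 + (2 * M)^-1) ^+ count L p * (a \notin p)%:R) <=
    1 + M^-1 * kgreen a (fun z => (L z)%:R) n x.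
Proof.
move=> M1 HM; have M0 : 0 < M by rewrite (lt_le_trans ltr01).
set g := 1 + _; have g1 : 1 <= g by rewrite lerDl invr_ge0 mulr_ge0// ltW.
have s0 y : 0 <= (L y)%:R :> R by [].
(* A visit lowers the expected number h of visits still to come by 1, which pays for the factor 1 +
   1/(2M): the two sides differ by (M - h + 1) / (2 M^2). *)
have step h : h <= M ->
    g * (1 + M^-1 * (h - 1)) <= 1 + M^-1 * h.
  move=> hM; rewrite /g.
  rewrite -subr_ge0 (_ : _ - _ = M^-1 * ((2 * M)^-1 * (M - h + 1)));
    last by field; rewrite gt_eqF.
  by rewrite !mulr_ge0// ?invr_ge0 ?mulr_ge0 ?ltW//; lra.
elim: n x => [|n IHn] x.
  rewrite /= in_cons in_nil orbF eq_sym addn0; case: eqP => _ /=.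
    by rewrite mulr0 mulr0 addr0.
  rewrite mulr1 addr0; case: (L x) => /=; last by rewrite expr0 mulr0 addr0.
  rewrite expr1 mulr1 /g lerD2l lef_pV2 ?posrE//; first by lra.
  by rewrite mulr_gt0.
have [->|xa] := eqVneq x a.
  rewrite kgreen_at mulr0 addr0 (le_trans _ ler01)//.
  rewrite -(@expect_cst R T nb nb_neq0 n.+1 a 0); apply: expect_le => p _ _.
  by rewrite in_cons eqxx mulr0.
have -> : expect nb n.+1 x (fun p => g ^+ count L p * (a \notin p)%:R) =
    g ^+ L x * avg (fun y => expect nb n y (fun p => g ^+ count L p * (a \notin p)%:R)) x.
  rewrite -avgZ; apply: avg_ext => y _; rewrite -expectZ; congr expect.
  apply/funext => p; rewrite /= in_cons eq_sym (negbTE xa)/= exprD mulrA.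
  by [].
set E := avg _ x.
have HE : E <= 1 + M^-1 * (kgreen a (fun z => (L z)%:R) n.+1 x - (L x)%:R).
  rewrite [kgreen _ _ _ _]/= (negbTE xa) addrAC subrr add0r.
  rewrite -avgZ -[X in _ <= X + _](avg_cst nb_neq0 1 x) -avgD.
  by apply: avg_le => y _; apply: IHn.
case Lx : (L x) HE => HE; last first.
  by rewrite expr0 mul1r; move: HE; rewrite subr0.
rewrite expr1; apply: le_trans (step _ (HM n.+1 x Lx)).
by rewrite ler_wpM2l// (le_trans ler01).
Qed.

(* theta ^+ m * V - zeta ^+ n is a subsolution for the probability of at      *)
(* least m visits to L, with discount zeta per step and theta per visit.      *)
Lemma expect_few_visits (L : pred T) (V : T -> R) (theta zeta : R) m n x :
  0 <= theta <= 1 -> 0 < zeta <= 1 ->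
  (forall y, V y <= 1) ->
  (forall y, ~~ L y -> V y <= zeta * avg V y) ->
  (forall y, L y -> theta * V y <= zeta * avg V y) ->
  expect nb n x (fun p => (count L p < m)%:R) <=
    1 - theta ^+ m * V x + zeta ^+ n.
Proof.
move=> /andP[t0 t1] /andP[z0 z1] V1 VL VL'.
have tm k y : theta ^+ k * V y <= 1.
  apply: (@le_trans _ _ (theta ^+ k * 1)); first by rewrite ler_wpM2l ?exprn_ge0.
  by rewrite mulr1 exprn_ile1.
have triv k (F : seq T -> R) y : (forall p, F p <= 1) -> expect nb k y F <= 1.
  move=> F1; rewrite -(@expect_cst R T nb nb_neq0 k y 1).
  by apply: expect_le.
elim: n m x => [|n IHn] m x.
  rewrite expr0; case: m => [|m] /=; first by rewrite expr0 mul1r; have := V1 x; lra.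
  by have := tm m.+1 x; case: (_ < _)%N => /=; lra.
(* Where the subsolution is nonpositive the claimed bound is at least 1. Elsewhere its positivity
   allows multiplying it by zeta <= 1. *)
have [H|H] := leP (theta ^+ m * V x) (zeta ^+ n.+1).
  apply: (@le_trans _ _ 1); last by lra.
  by apply: triv => p; case: (_ < _)%N.
have zn : zeta ^+ n.+1 = zeta * zeta ^+ n by rewrite exprS.
have key k : theta ^+ m * V x <= zeta * (theta ^+ k * avg V x) ->
   avg (fun y => expect nb n y (fun p => (count L p < k)%:R)) x <=
   1 - theta ^+ m * V x + zeta ^+ n.+1.
  move=> Hk.
  apply: (@le_trans _ _ (avg (fun y => 1 + zeta ^+ n + (- theta ^+ k) * V y) x)).
    by apply: avg_le => y _; have := IHn k y; lra.
  rewrite avgD avg_cst// avgZ.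
  set A := theta ^+ m * V x in Hk H *; set B := theta ^+ k * avg V x in Hk *.
  set Z := zeta ^+ n in zn *.
  rewrite zn in H *; rewrite mulNr -/B.
  have : zeta * (A - zeta * Z) <= A - zeta * Z by rewrite ler_piMl// subr_ge0 ltW.
  have : zeta * (1 + Z - B) <= zeta * (1 - A + zeta * Z) -> 1 + Z - B <= 1 - A + zeta * Z.
    by rewrite ler_pM2l.
  nra.
have [Lx|Lx] := boolP (L x).
  case: m H key => [|m] H key.
    apply: (@le_trans _ _ 0); last by have := tm 0%N x; have := exprn_ge0 n.+1 (ltW z0); lra.
    by rewrite -[leRHS](@expect_cst R T nb nb_neq0 n.+1 x 0); apply: expect_le => p _ _.
  have -> : expect nb n.+1 x (fun p => (count L p < m.+1)%:R) =
      avg (fun y => expect nb n y (fun p => (count L p < m)%:R)) x.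
    by apply: avg_ext => y _; congr expect; apply/funext => p /=; rewrite Lx add1n ltnS.
  apply: key; rewrite exprSr -mulrA [leRHS]mulrCA ler_wpM2l ?exprn_ge0//.
  exact: VL'.
have -> : expect nb n.+1 x (fun p => (count L p < m)%:R) =
    avg (fun y => expect nb n y (fun p => (count L p < m)%:R)) x.
  by apply: avg_ext => y _; congr expect; apply/funext => p /=; rewrite (negbTE Lx) add0n.
by apply: key; rewrite [leRHS]mulrCA ler_wpM2l ?exprn_ge0// VL.
Qed.

End Killed.

(** * The cylinder *)

Section CylinderNeighbors.
Variables (V : finType) (e : rel V).
Hypothesis e_sym : symmetric e.
Implicit Types x y : cylinder V.

Definition cnb x : seq (cylinder V) :=
  (x.1, x.2 + 1) :: (x.1, x.2 - 1) :: [seq (v, x.2) | v <- enum (e x.1)].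

Lemma mem_cnb x y : (y \in cnb x) = cyl_adj e x y.
Proof.
case: x y => [a u] [b v]; rewrite /cyl_adj !in_cons /= -!pair_eqE /=.
have -> : ((b, v) \in [seq (v0, u) | v0 <- enum (e a)]) = (u == v) && e a b.
  apply/mapP/andP => [[c]|[/eqP<- eab]].
    by rewrite mem_enum => eac [-> ->]; split.
  by exists b => //; rewrite mem_enum.
rewrite orbA; congr (_ || _); rewrite -andb_orr [b == a]eq_sym; congr (_ && _).
by lia.
Qed.

Lemma cnb_neq0 x : cnb x != [::]. Proof. by []. Qed.

Lemma cnb_sym x y : (y \in cnb x) = (x \in cnb y).
Proof. by rewrite !mem_cnb /cyl_adj e_sym distrC ![_ == y.1]eq_sym ![_ == y.2]eq_sym. Qed.

Lemma cnb_uniq x : uniq (cnb x).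
Proof.
rewrite /cnb /= !in_cons !negb_or -!andbA map_inj_uniq; last by move=> u v [].
rewrite enum_uniq andbT -!pair_eqE /= eqxx /=; apply/and3P; split; first by lia.
  by apply/mapP => -[v _ [_]]; lia.
by apply/mapP => -[v _ [_]]; lia.
Qed.

Lemma cyl_degE x : cyl_deg e x = size (cnb x).
Proof.
rewrite /cyl_deg.
have -> : [set y | cyl_adj e x y] = [set` [fset y in cnb x]%fset].
  by apply/seteqP; split => y; rewrite /= in_fset mem_cnb.
by rewrite set_fsetK card_fseq undup_id ?cnb_uniq.
Qed.

Lemma size_cnb x : size (cnb x) = (#|e x.1|).+2.
Proof. by rewrite /= size_map -cardE. Qed.

Lemma sum_cnb (R : realType) (F : cylinder V -> R) x :
  \sum_(y <- cnb x) F y =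
    F (x.1, x.2 + 1) + F (x.1, x.2 - 1) + \sum_(v | e x.1 v) F (v, x.2).
Proof. by rewrite !big_cons big_map big_enum addrA. Qed.

Lemma cnb_close x y : y \in cnb x -> `|y.2 - x.2| <= 1.
Proof. by rewrite mem_cnb /cyl_adj => /orP[/andP[_]|/andP[/eqP]]; lia. Qed.

Lemma walk_close x p y : path (step_rel cnb) x p -> y \in x :: p ->
  `|y.2 - x.2| <= (size p)%:Z.
Proof.
elim: p x => [|z p IHp] x /=; first by rewrite mem_seq1 => _ /eqP->; rewrite subrr.
move=> /andP[xz pz]; rewrite in_cons => /predU1P[->|/(IHp _ pz)].
  by rewrite subrr.
move=> yz; apply: (le_trans (ler_distD z.2 _ _)).
by rewrite -addn1 PoszD lerD// cnb_close.
Qed.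

End CylinderNeighbors.

(** * The law of the walk *)

Lemma tree_adj_sym r N : symmetric (@tree_adj r N).
Proof. by move=> u v; rewrite /tree_adj orbC. Qed.

Section Law.
Variables (R : realType) (r N : nat) (x0 : cylinder (tree r N)).
Variable P : probability (trajectories (tree r N)) R.
Hypothesis hP : is_srw_law (@tree_adj r N) x0 P.

Local Notation nb := (cnb (@tree_adj r N)).
Local Notation T := (cylinder (tree r N)).

Lemma measurable_coord n (y : T) :
  measurable ([set X | X n = y] : set (trajectories (tree r N))).
Proof. by apply: sub_sigma_algebra; exists (n, y). Qed.

(** There are countably many prefixes, and prescribing one of them is a finite intersection of
    coordinate events. *)
Lemma measurable_prefix n (A : set (seq T)) :
  measurable ([set X | A (mkseq X n)] : set (trajectories (tree r N))).
Proof.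
have -> : [set X | A (mkseq X n)] = \bigcup_p
    ([set X | A p /\ mkseq X n = p] : set (trajectories (tree r N))).
  apply/seteqP; split => X; first by move=> AX; exists (mkseq X n).
  by move=> [p _ /= [Ap pX]]; rewrite pX.
apply: countable_bigcupT_measurable; first exact: countableP.
move=> p; have [Ap|nAp] := pselect (A p); last first.
  rewrite [X in measurable X](_ : _ = set0) ?measurable0//.
  by apply/seteqP; split => X //= [].
rewrite [X in measurable X](_ : _ = [set X | mkseq X n = p]); last first.
  by apply/seteqP; split => X //= [].
have [sp|sp] := eqVneq (size p) n; last first.
  rewrite [X in measurable X](_ : _ = set0) ?measurable0//.
  by apply/seteqP; split => X //= pX; move: sp; rewrite -pX size_mkseq eqxx.
rewrite [X in measurable X](_ : _ =
    \bigcap_(i in `I_n) ([set X | X i = nth x0 p i] : set (trajectories (tree r N)))).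
  by apply: bigcap_measurableType => i _; apply: measurable_coord.
apply/seteqP; split => X; first by move=> /= pX i ilt; rewrite -pX nth_mkseq.
move=> H; apply: (@eq_from_nth _ x0); first by rewrite size_mkseq sp.
by move=> i; rewrite size_mkseq => ilt; rewrite nth_mkseq// H.
Qed.

Fixpoint walks n x : seq (seq T) :=
  if n is n'.+1 then flatten [seq map (cons x) (walks n' y) | y <- nb x]
  else [:: [:: x]].

Lemma walksS n x :
  walks n.+1 x = flatten [seq map (cons x) (walks n y) | y <- nb x].
Proof. by []. Qed.

Lemma walks_head n x p : p \in walks n x -> exists p', p = x :: p' /\ size p' = n.
Proof.
elim: n x p => [|n IHn] x p; first by rewrite mem_seq1 => /eqP->; exists [::].
rewrite walksS =>  /flatten_mapP[y _ /mapP[q /IHn[q' [-> sq]] ->]]; exists (y :: q').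
by split; rewrite //= sq.
Qed.

Lemma walks_uniq n x : uniq (walks n x).
Proof.
elim: n x => [//|n IHn] x; rewrite walksS.
have : uniq (nb x) by apply: cnb_uniq.
elim: (nb x) => [//|y s IHs] /= /andP[ys us].
rewrite cat_uniq map_inj_uniq; last by move=> p q [].
rewrite IHn IHs// andbT; apply/hasPn => p /flatten_mapP[z zs /mapP[q qz ->]].
apply/mapP => -[q' q'y [qq']]; move: zs ys; rewrite -qq' in q'y.
have [p1 [e1 _]] := walks_head qz; have [p2 [e2 _]] := walks_head q'y.
by move: e2; rewrite e1 => -[<- _] ->.
Qed.

Definition walk_weight (p : seq T) : R :=
  \prod_(i < (size p).-1) srw_step (@tree_adj r N) R (nth x0 p i) (nth x0 p i.+1).

Lemma expect_walks n x (F : seq T -> R) :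
  expect nb n x F = \sum_(p <- walks n x) walk_weight p * F p.
Proof.
elim: n x F => [|n IHn] x F.
  by rewrite big_seq1 /walk_weight big_ord0 mul1r.
rewrite [LHS]/= walksS big_flatten big_map /avg big_distrl.
apply: eq_big_seq => y yx; rewrite big_map IHn big_distrl.
apply: eq_big_seq => p /walks_head[q [-> sq]] /=; rewrite mulrAC; congr (_ * _).
rewrite /walk_weight /= big_ord_recl mulrC; congr (_ * _).
by rewrite /srw_step /= -mem_cnb yx cyl_degE.
Qed.

Lemma prob_walk n p : p \in walks n x0 ->
  P [set X | mkseq X n.+1 = p] = (walk_weight p)%:E.
Proof.
move=> /walks_head[q [ep sq]].
have -> : [set X | mkseq X n.+1 = p] =
    [set X | forall i, (i <= n)%N -> X i = nth x0 p i].
  apply/seteqP; split => X; first by move=> /= pX i ilt; rewrite -pX nth_mkseq.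
  move=> H; apply: (@eq_from_nth _ x0); first by rewrite size_mkseq ep /= sq.
  by move=> i; rewrite size_mkseq => ilt; rewrite nth_mkseq// H.
rewrite hP /walk_weight ep /= eqxx mul1r sq; congr (_%:E).
Qed.

Lemma prob_mem_seq n (s : seq (seq T)) : uniq s ->
  P [set X | mkseq X n \in s] = (\sum_(p <- s) P [set X | mkseq X n = p])%E.
Proof.
elim: s => [_|p s IHs /= /andP[ps us]].
  rewrite big_nil (_ : [set X | _] = set0) ?measure0//.
  by apply/seteqP; split.
rewrite big_cons -IHs// -measureU.
- congr (P _); apply/seteqP; split => X /=; rewrite in_cons.
    by move=> /predU1P[]; [left|right].
  by move=> [->|->]; rewrite ?eqxx ?orbT.
- exact: (@measurable_prefix n [set q | q = p]).
- exact: (@measurable_prefix n [set q | q \in s]).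
- by apply/seteqP; split => X //= [->]; rewrite (negbTE ps).
Qed.

(** The listed walks that fail A have total mass 1 - q, so the complementary event has at least this
    mass. Passing to the complement spares computing the mass of the sequences that are not
    walks. *)
Lemma prob_prefix_le n (A : set (seq T)) :
  (P [set X | A (mkseq X n.+1)] <= (expect nb n x0 (fun p => `[< A p >]%:R))%:E)%E.
Proof.
have mA : measurable ([set X | A (mkseq X n.+1)] : set (trajectories (tree r N))).
  exact: measurable_prefix.
have nb0 : forall x, nb x != [::] by exact: cnb_neq0.
set q := expect _ _ _ _.
have qE : expect nb n x0 (fun p => `[< ~ A p >]%:R) = 1 - q.
  rewrite -[X in X - _](expect_cst nb0 n x0 1) /q -[_ - _]/(_ + _) -mulN1r -expectZ -expectD.
  congr expect; apply/funext => p; rewrite asbool_neg.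
  by case: (asbool (A p)); rewrite /= ?mulr1 ?mulr0 ?addr0 ?subrr.
pose s := [seq p <- walks n x0 | `[< ~ A p >]].
have us : uniq s by rewrite filter_uniq// walks_uniq.
have sE : P [set X | mkseq X n.+1 \in s] = (1 - q)%:E.
  rewrite prob_mem_seq// -qE expect_walks /s big_filter big_mkcond -sumEFin.
  apply: eq_big_seq => p pw; case: (asbool (~ A p)); last by rewrite mulr0.
  by rewrite prob_walk// mulr1.
have : (P [set X | mkseq X n.+1 \in s] <= P (~` [set X | A (mkseq X n.+1)]))%E.
  apply: le_measure; rewrite ?inE.
  - exact: (@measurable_prefix n.+1 [set q | q \in s]).
  - exact: measurableC.
  - by move=> X /=; rewrite mem_filter => /andP[/asboolP].
rewrite sE probability_setC// -(fineK (fin_num_measure P _ mA)) -EFinB !lee_fin.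
by move=> ?; lra.
Qed.
End Law.

(** * Disconnection *)

Section Linked.
Variables (V : finType) (e : rel V) (S : set (cylinder V)).
Hypothesis e_sym : symmetric e.
Implicit Types x y : cylinder V.

Lemma cyl_adj_sym x y : cyl_adj e x y = cyl_adj e y x.
Proof. by rewrite /cyl_adj e_sym distrC ![_ == y.1]eq_sym ![_ == y.2]eq_sym. Qed.

Lemma linked_refl x : ~ S x -> linked_off e S x x.
Proof. by move=> Sx; exists [::]; split => // z; rewrite mem_seq1 => /eqP->. Qed.

Lemma linked_trans x y z :
  linked_off e S x y -> linked_off e S y z -> linked_off e S x z.
Proof.
move=> [p [xp lp Sp]] [q [yq lq Sq]]; exists (p ++ q); split.
- by rewrite cat_path xp lp.
- by rewrite last_cat lp.
- move=> w; rewrite -cat_cons mem_cat => /orP[/Sp//|wq].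
  by apply: Sq; rewrite in_cons wq orbT.
Qed.

Lemma linked_step x y : ~ S x -> ~ S y -> cyl_adj e x y -> linked_off e S x y.
Proof.
move=> Sx Sy xy; exists [:: y]; split => //=; first by rewrite xy.
by move=> z; rewrite !inE => /orP[]/eqP->.
Qed.

Lemma linked_sym x y : linked_off e S x y -> linked_off e S y x.
Proof.
move=> [p []]; elim: p x => [|z p IHp] x /=.
  by move=> _ <- H; apply: linked_refl; apply: H; rewrite mem_head.
move=> /andP[xz zp] lp H.
have Sz : ~ S z by apply: H; rewrite !in_cons eqxx orbT.
apply: (@linked_trans _ z).
  by apply: IHp => // w wp; apply: H; rewrite in_cons wp orbT.
by apply: linked_step => //; [apply: H; rewrite mem_head|rewrite cyl_adj_sym].
Qed.

Lemma linked_vertical v (a b : int) : a <= b ->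
  (forall z, a <= z <= b -> ~ S (v, z)) -> linked_off e S (v, a) (v, b).
Proof.
move=> ab; have [n ->] : exists n : nat, b = a + n%:Z.
  by exists `|b - a|%N; lia.
elim: n => [|n IHn] H.
  by rewrite addr0; apply: linked_refl; apply: H; lia.
apply: (@linked_trans _ (v, a + n%:Z)).
  by apply: IHn => z zab; apply: H; lia.
apply: linked_step; [by apply: H; lia|by apply: H; lia|].
by rewrite /cyl_adj /= eqxx /= (_ : _ == 1)//; lia.
Qed.

Lemma path_crosses (z0 : int) x p : path (cyl_adj e) x p ->
  z0 <= x.2 -> (last x p).2 <= z0 -> exists2 y, y \in x :: p & y.2 = z0.
Proof.
elim: p x => [|y p IHp] x /=.
  by move=> _ zx xz; exists x; rewrite ?mem_head//; apply/eqP; rewrite eq_le zx xz.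
move=> /andP[xy yp] zx lz; have [->|xz] := eqVneq z0 x.2.
  by exists x; rewrite ?mem_head.
have zy : z0 <= y.2.
  have : `|x.2 - y.2| <= 1 by move: xy => /orP[/andP[_]|/andP[/eqP]]; lia.
  by move: zx xz; lia.
by have [w wp wz] := IHp y yp zy lz; exists w => //; rewrite in_cons wp orbT.
Qed.

End Linked.

Section TreeCylinder.
Variables (r N : nat) (S : set (cylinder (tree r N))).
Local Notation e := (@tree_adj r N).
Local Notation linked := (linked_off e S).

Definition tree_root : tree r N := [bseq].

Definition ancestor k (f : tree r N) : tree r N := [bseq of take k f].

Lemma tree_adj_ancestor k (f : tree r N) : (k < size f)%N ->
  tree_adj (ancestor k f) (ancestor k.+1 f).
Proof.
case f0 : (bseqval f) => [//|a s]; rewrite -f0 => kf; apply/orP; left.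
by apply/existsP; exists (nth a f k); rewrite /= -take_nth.
Qed.

Lemma linked_root (f : tree r N) z :
  (forall k, ~ S (ancestor k f, z)) -> linked (tree_root, z) (f, z).
Proof.
move=> H; have rootE : ancestor 0 f = tree_root by apply: val_inj; rewrite /= take0.
have fE : ancestor (size f) f = f by apply: val_inj; rewrite /= take_size.
suff : forall k, (k <= size f)%N -> linked (tree_root, z) (ancestor k f, z).
  by move=> /(_ (size f) (leqnn _)); rewrite fE.
elim=> [_|k IHk kf]; first by rewrite rootE; apply: linked_refl; rewrite -rootE.
apply: linked_trans (IHk (ltnW kf)) _; apply: linked_step; [exact: H|exact: H|].
by rewrite /cyl_adj /= eqxx tree_adj_ancestor ?orbT.
Qed.

(** Beyond height B, above or below, everything is free and joined through the column of the root,
    while a path from top to bottom changes height by at most 1 per step and so meets the level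
    z0. *)
Lemma cover_disconnects (z0 : int) (B : nat) :
  (forall x, S x -> `|x.2| <= B%:Z) -> (forall g, S (g, z0)) -> disconnects e S.
Proof.
move=> SB cov; exists B.+1 => // M /= BM.
have far (x : cylinder (tree r N)) : M%:Z <= `|x.2| -> ~ S x by move=> Mx /SB; lia.
have z0B := SB _ (cov tree_root); rewrite /= in z0B.
exists [set y | linked (tree_root, M%:Z) y], [set y | linked (tree_root, - M%:Z) y].
split.
- by exists (tree_root, M%:Z) => //; apply: far => /=; lia.
- by exists (tree_root, - M%:Z) => //; apply: far => /=; lia.
- move=> C12; have : [set y | linked (tree_root, M%:Z) y] (tree_root, - M%:Z).
    by rewrite C12 /=; apply: linked_refl; apply: far => /=; lia.
  move=> [p [pp lp Sp]].
  have [|| [g z] yp /= yz] := path_crosses (z0 := z0) pp; rewrite ?lp/=; try lia.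
  by apply: (Sp _ yp); rewrite yz.
- move=> [g z] /= Mz; apply: (@linked_trans _ _ _ _ (tree_root, z)).
    by apply: linked_vertical => // w wM; apply: far => /=; lia.
  by apply: linked_root => k; apply: far => /=; lia.
- move=> [g z] /= zM; apply: (@linked_trans _ _ _ _ (tree_root, z)).
    apply: linked_sym; first exact: tree_adj_sym.
    by apply: linked_vertical => // w wM; apply: far => /=; lia.
  by apply: linked_root => k; apply: far => /=; lia.
Qed.

(** From the free level of slab i, follow F to a vertex f whose column is free over slabs i and i +
    1, climb to the free level of slab i + 1, and return to the root. Closure under ancestors keeps
    both horizontal moves inside F. *)
Lemma free_levels_not_disconnects (F : pred (tree r N)) (H : nat) (v : int -> int) :
  (0 < H)%N -> (forall k f, F f -> F (ancestor k f)) ->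
  (forall i, i * H%:Z <= v i < (i + 1) * H%:Z) ->
  (forall i f, F f -> ~ S (f, v i)) ->
  (forall i, exists2 f, F f & forall z, i * H%:Z <= z < (i + 2) * H%:Z -> ~ S (f, z)) ->
  ~ disconnects e S.
Proof.
move=> H0 Fanc vH Fv Fl [M _ /(_ M (leqnn _))[C1 [C2 [[x1 Sx1 eC1] [x2 Sx2 eC2] C12 top bot]]]].
have adj i : linked (tree_root, v i) (tree_root, v (i + 1)).
  have [f Ff Sf] := Fl i.
  have ff j : linked (tree_root, v j) (f, v j).
    by apply: linked_root => k; apply: Fv; apply: Fanc.
  apply: linked_trans (ff i) _.
  apply: linked_trans (linked_sym (@tree_adj_sym r N) (ff (i + 1))).
  apply: linked_vertical; first by have := vH i; have := vH (i + 1); lia.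
  by move=> z zv; apply: Sf; have := vH i; have := vH (i + 1); nia.
have far i n : linked (tree_root, v i) (tree_root, v (i + n%:Z)).
  elim: n => [|n IHn].
    have [f Ff _] := Fl i; rewrite addr0; apply: linked_refl.
    have -> : tree_root = ancestor 0 f by apply: val_inj; rewrite /= take0.
    by apply: Fv; apply: Fanc.
  apply: linked_trans IHn _; rewrite -addn1 PoszD addrA; exact: adj.
have l1 : linked x1 (tree_root, v M%:Z).
  have : C1 (tree_root, v M%:Z) by apply: top => /=; have := vH M%:Z; nia.
  by rewrite eC1.
have l2 : linked x2 (tree_root, v (- M.+1%:Z)).
  have : C2 (tree_root, v (- M.+1%:Z)) by apply: bot => /=; have := vH (- M.+1%:Z); nia.
  by rewrite eC2.
have l3 := far (- M.+1%:Z) (M.+1 + M)%N.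
rewrite (_ : - M.+1%:Z + (M.+1 + M)%N%:Z = M%:Z) in l3; last by lia.
have sym := linked_sym (@tree_adj_sym r N).
have l12 : linked x1 x2.
  exact: linked_trans l1 (linked_trans (sym _ _ _ l3) (sym _ _ _ l2)).
apply: C12; rewrite eC1 eC2; apply/seteqP; split => y /= xy.
  exact: linked_trans (sym _ _ _ l12) xy.
exact: linked_trans l12 xy.
Qed.

End TreeCylinder.

(** * A superharmonic weight on the tree *)

Section TreeNeighbors.
Variables (r N : nat).
Implicit Types u v : tree r N.

Lemma sum_children (R : nmodType) (F : seq 'I_r -> R) u :
  \sum_(v | is_child u v) F v =
    if (size u < N)%N then \sum_(i < r) F (rcons u i) else 0.
Proof.
case: ltnP => uN; last first.
  rewrite big_pred0// => v; apply/existsP => -[i /eqP /(congr1 size)].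
  by rewrite size_rcons => sv; have := size_bseq v; rewrite sv ltnNge uN.
have sz i : (size (rcons u i) <= N)%N by rewrite size_rcons.
pose ch i : tree r N := Bseq (sz i).
rewrite (eq_bigl (fun v => v \in codom ch)); last first.
  move=> v; apply/existsP/codomP => -[i].
    by move=> /eqP vi; exists i; apply: val_inj.
  by move=> ->; exists i.
have -> : \sum_(v in codom ch) F v = \sum_(v <- codom ch) F v.
  rewrite big_uniq//= map_inj_uniq ?enum_uniq// => i j [] /eqP.
  by rewrite eqseq_rcons => /andP[_ /eqP].
by rewrite big_map big_enum.
Qed.

Lemma sum_parent (R : nmodType) (F : seq 'I_r -> R) u :
  \sum_(v | is_child v u) F v =
    if bseqval u is a :: s then F (take (size s) (a :: s)) else 0.
Proof.
have [u0|] := eqVneq (bseqval u) [::].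
  rewrite u0 big_pred0// => v; apply/existsP => -[i].
  by rewrite u0; case: (bseqval v).
case us : (bseqval u) => [//|a s] _.
pose p : tree r N := ancestor (size s) u.
rewrite (big_pred1 p) /= ?us// => v /=; apply/existsP/eqP => [[i /eqP]|->].
  move=> ui; apply: val_inj; rewrite /= ui.
  move: ui; rewrite us => /(congr1 size); rewrite size_rcons => -[->].
  by rewrite -cats1 take_size_cat.
exists (last a s); rewrite /= us; apply/eqP.
have -> : last a s = nth a (a :: s) (size s) by rewrite nth_last.
by rewrite -take_nth//= take_size.
Qed.

Lemma sum_tree_adj (R : nmodType) (F : seq 'I_r -> R) u :
  \sum_(v | tree_adj u v) F v =
    (if (size u < N)%N then \sum_(i < r) F (rcons u i) else 0) +
    (if bseqval u is a :: s then F (take (size s) (a :: s)) else 0).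
Proof.
rewrite -sum_children -sum_parent (bigID (is_child u))/=; congr (_ + _).
  by apply: eq_bigl => v; rewrite /tree_adj; case: is_child; rewrite ?andbT ?andbF.
apply: eq_bigl => v; rewrite /tree_adj.
have [/existsP[i /eqP uv]|] := boolP (is_child u v); last by rewrite andbT.
symmetry; rewrite andbF; apply/existsP => -[j /eqP vu].
by have := congr1 size uv; have := congr1 size vu; rewrite !size_rcons; lia.
Qed.

Lemma card_tree_adj u :
  #|tree_adj u| = ((if (size u < N)%N then r else 0) + (0 < size u))%N.
Proof.
rewrite -sum1_card (sum_tree_adj (fun=> 1%N)); congr (_ + _)%N; last first.
  by case: (bseqval u).
by rewrite sum1_card card_ord.
Qed.

Lemma card_tree_adj_le u : (#|tree_adj u| <= r.+1)%N.
Proof. by rewrite card_tree_adj; case: ifP; case: (0 < _)%N; lia. Qed.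

End TreeNeighbors.

(* On the path from the root to f the weight grows by 1/a at each step; off   *)
(* that path it shrinks by b at each step away from it.                       *)
Definition tree_weight (R : realType) (T : eqType) (a b : R) (f y : seq T) : R :=
  a ^+ size f * \prod_(k < size y) (if prefix (take k.+1 y) f then a^-1 else b).

Section TreeWeight.
Variables (R : realType) (r : nat) (a b k : R).
Hypotheses (a0 : 0 < a) (a1 : a <= 1) (b0 : 0 < b) (b1 : b <= 1) (k0 : 0 <= k).
Hypothesis h1 : a^-1 + (r%:R - 1) * b + k <= r%:R.
Hypothesis h2 : r%:R * b + b^-1 + k <= r%:R + 1.
Local Notation w := (tree_weight a b).
Implicit Types f y : seq 'I_r.

Lemma inva_ge1 : 1 <= a^-1. Proof. by rewrite invf_ge1. Qed.

Lemma tree_weight_rcons f y i :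
  w f (rcons y i) = w f y * (if prefix (rcons y i) f then a^-1 else b).
Proof.
rewrite /tree_weight size_rcons big_ord_recr /= mulrA; congr (_ * _ * _).
  apply: eq_bigr => j _; rewrite -cats1 takel_cat//.
by rewrite -(size_rcons y i) take_size.
Qed.

Lemma tree_weight_gt0 f y : 0 < w f y.
Proof.
rewrite mulr_gt0 ?exprn_gt0// prodr_gt0// => j _.
by case: ifP; rewrite ?invr_gt0.
Qed.

Lemma tree_weight_self f : w f f = 1.
Proof.
rewrite /tree_weight (eq_bigr (fun=> a^-1)).
  by rewrite prodr_const card_ord -exprMn mulfV ?expr1n// gt_eqF.
by move=> j _; rewrite prefix_take.
Qed.

(** Only the first m letters of y can follow f. Their factors 1/a are absorbed by a^|f|, and every
    later letter contributes b. *)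
Lemma tree_weight_le f y m : (m <= size f)%N -> (m <= size y)%N ->
  (forall j, (m <= j < size y)%N -> ~~ prefix (take j.+1 y) f) ->
  w f y <= b ^+ (size y - m).
Proof.
move=> mf my H; rewrite /tree_weight.
have fac (j : 'I_(size y)) : 0 <= (if prefix (take j.+1 y) f then a^-1 else b).
  by case: ifP; rewrite ?invr_ge0 ltW.
apply: (@le_trans _ _ (a ^+ size f *
    \prod_(j < size y) (if (j < m)%N then a^-1 else b))).
  apply: ler_wpM2l; first by rewrite exprn_ge0 ?ltW.
  apply: ler_prod => j _; rewrite fac/=.
  case: (ltnP j m) => jm; last first.
    by rewrite (negbTE (H j _))// jm ltn_ord.
  by case: ifP => // _; apply: le_trans b1 inva_ge1.
rewrite (bigID (fun j : 'I_(size y) => (j < m)%N))/=.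
rewrite (eq_bigr (fun=> a^-1)); last by move=> j ->.
rewrite [X in _ * (_ * X)](eq_bigr (fun=> b)); last by move=> j /negbTE->.
rewrite !prodr_const.
have c1 : #|[pred j : 'I_(size y) | (j < m)%N]| = m.
  by rewrite -sum1_card -(big_ord_widen _ (fun=> 1%N) my) sum1_card card_ord.
have c2 : #|[pred j : 'I_(size y) | ~~ (j < m)%N]| = (size y - m)%N.
  have := cardC [pred j : 'I_(size y) | (j < m)%N]; rewrite c1 card_ord => E.
  by rewrite -[in RHS]E addKn; apply: eq_card.
rewrite c1 c2 mulrA ler_piMl ?exprn_ge0 ?(ltW b0)//.
rewrite -(subnK mf) exprD -mulrA -exprMn mulfV ?gt_eqF// expr1n mulr1.
by rewrite exprn_ile1 ?(ltW a0).
Qed.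

Lemma sum_child_factors f y :
  \sum_(i < r) (if prefix (rcons y i) f then a^-1 else b) <=
    if prefix y f then a^-1 + (r%:R - 1) * b else r%:R * b.
Proof.
have [yf|yf] := boolP (prefix y f); last first.
  rewrite (eq_bigr (fun=> b)) ?sumr_const ?card_ord ?mulr_natl// => i _.
  case: ifP => // /prefixP[s fs]; case/negP: yf; apply/prefixP.
  by exists (i :: s); rewrite fs cat_rcons.
have [/existsP[i yif]|/existsPn none] := boolP [exists i, prefix (rcons y i) f].
  rewrite (bigD1 i)//= yif lerD2l (eq_bigr (fun=> b)).
    have r0 : (0 < r)%N := leq_ltn_trans (leq0n i) (ltn_ord i).
    by rewrite sumr_const cardC1 card_ord -[b *+ _]mulr_natl -subn1 natrB.
  move=> j ji; case: ifP => // yjf; case/eqP: ji.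
  move: yif yjf => /prefixP[s ->] /prefixP[t]; rewrite !cat_rcons => /eqP.
  by rewrite eqseq_cat// => /andP[_ /eqP[->]].
rewrite (eq_bigr (fun=> b)) => [|i _]; last by rewrite (negbTE (none i)).
rewrite sumr_const card_ord -[b *+ _]mulr_natl mulrBl mul1r addrCA lerDl subr_ge0.
exact: le_trans b1 inva_ge1.
Qed.

(** Relative to the weight of y, the neighbors sum to at most 1/a + (r - 1) b + a on the path to f,
    where a <= 1, and to r b + 1/b off it; [h1] and [h2] leave the surplus k. *)
Lemma tree_weight_super N f (y : tree r N) : (size y < N)%N ->
  \sum_(v | tree_adj y v) w f v + k * w f y <= #|tree_adj y|%:R * w f y.
Proof.
move=> yN; rewrite (sum_tree_adj (fun v => w f v)) yN card_tree_adj yN.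
rewrite (eq_bigr _ (fun i _ => tree_weight_rcons f y i)) -big_distrr/=.
have w0 := tree_weight_gt0 f y; have := sum_child_factors f y.
set S := \sum_(i < r) _ => HS.
have par : (if bseqval y is a :: s then w f (take (size s) (a :: s)) else 0) =
    (0 < size y)%:R * ((if prefix y f then a else b^-1) * w f y).
  case/lastP yE : (bseqval y) => [|s i]; first by rewrite mul0r.
  rewrite size_rcons mul1r tree_weight_rcons.
  have -> : (if rcons s i is a :: s then w f (take (size s) (a :: s)) else 0) = w f s.
    case E : (rcons s i) (size_rcons s i) => [//|x t] /= [st].
    by rewrite -[x :: _]E st -cats1 take_size_cat.
  by case: ifP => _; rewrite mulrCA ?mulfV ?mulVf ?mulr1// gt_eqF.
rewrite par natrD.
have [y0|y0] := posnP (size y).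
  rewrite mul0r !addr0 mulrC -mulrDl ler_wpM2r ?(ltW w0)//.
  move: HS; rewrite (_ : prefix y f); last by rewrite (size0nil y0) prefix0s.
  by move: h1; lra.
rewrite -[true%:R]/(1 : R) !mul1r addrAC mulrC -!mulrDl ler_wpM2r ?(ltW w0)//.
by move: HS; case: ifP => _; [have := a1; have := h1|have := h2]; lra.
Qed.

(** At a leaf superharmonicity fails: the only neighbor is the parent, heavier by the factor 1/b.
    This defect is repaired in [cylinder_super]. *)
Lemma tree_weight_leaf N f (y : tree r N) : size y = N -> (size f < N)%N ->
  \sum_(v | tree_adj y v) w f v = w f y / b.
Proof.
move=> yN fN; rewrite (sum_tree_adj (fun v => w f v)) yN ltnn add0r.
case/lastP yE : (bseqval y) => [|s i].
  by move: yN fN; rewrite yE => <-.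
rewrite tree_weight_rcons.
have -> : (if rcons s i is a :: s then w f (take (size s) (a :: s)) else 0) = w f s.
  case E : (rcons s i) (size_rcons s i) => [//|x t] /= [st].
  by rewrite -[x :: _]E st -cats1 take_size_cat.
case: ifP => [/size_prefix|_]; last by rewrite mulfK// gt_eqF.
by rewrite -yE yN leqNgt fN.
Qed.

Lemma tree_weight_leaf_le N f (y : tree r N) : size y = N -> (size f < N)%N ->
  w f y <= b ^+ (N - size f).
Proof.
move=> yN fN; rewrite -{2}yN; apply: tree_weight_le => //.
  by rewrite yN ltnW.
move=> j /andP[fj jy]; apply/negP => /size_prefix.
by rewrite size_takel// ltnNge fj.
Qed.

End TreeWeight.

(** * The Green function of the cylinder *)

Section Hat.
Variable R : realType.

Definition hat (q : R) (v z : int) : R := q ^+ absz (z - v)%R.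

Lemma hat_gt0 (q : R) v z : 0 < q -> 0 < hat q v z.
Proof. exact: exprn_gt0. Qed.

Lemma hat_le1 (q : R) v z : 0 <= q <= 1 -> hat q v z <= 1.
Proof. by move=> /andP[q0 q1]; apply: exprn_ile1. Qed.

Lemma hat_at (q : R) v : hat q v v = 1.
Proof. by rewrite /hat subrr expr0. Qed.

Lemma hat_sum_at (q : R) v : hat q v (v + 1) + hat q v (v - 1) = 2 * q.
Proof.
rewrite /hat (_ : absz (v + 1 - v)%R = 1%N); last by lia.
by rewrite (_ : absz (v - 1 - v)%R = 1%N) ?expr1; [ring|lia].
Qed.

Lemma hat_sum (q : R) v z : 0 < q -> z != v ->
  hat q v (z + 1) + hat q v (z - 1) = (q + q^-1) * hat q v z.
Proof.
move=> q0 zv; have [n Hn] : exists n, absz (z - v)%R = n.+1 by exists (absz (z - v)%R).-1; lia.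
rewrite /hat Hn; have [zv'|zv'] := ltP v z.
  rewrite (_ : absz (z + 1 - v)%R = n.+2); last by lia.
  rewrite (_ : absz (z - 1 - v)%R = n); last by lia.
  by rewrite !exprS; field; rewrite gt_eqF.
rewrite (_ : absz (z + 1 - v)%R = n); last by lia.
rewrite (_ : absz (z - 1 - v)%R = n.+2); last by lia.
by rewrite !exprS; field; rewrite gt_eqF.
Qed.

Lemma sum_hat_le (q : R) v z : 0 < q -> q <= 1 ->
  hat q v (z + 1) + hat q v (z - 1) <= (q + q^-1) * hat q v z.
Proof.
move=> q0 q1; have [->|zv] := eqVneq z v; last by rewrite hat_sum.
rewrite hat_sum_at hat_at mulr1.
have : 1 <= q^-1 by rewrite invf_ge1.
lra.
Qed.

End Hat.

Section GreenBound.
Variables (R : realType) (r : nat) (a b k c : R).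
Hypotheses (a0 : 0 < a) (a1 : a <= 1) (b0 : 0 < b) (b1 : b <= 1).
Hypotheses (k0 : 0 < k) (k2 : k <= 2).
Hypothesis h1 : a^-1 + (r%:R - 1) * b + k <= r%:R.
Hypothesis h2 : r%:R * b + b^-1 + k <= r%:R + 1.
Hypotheses (c0 : 0 < c) (c1 : c < 1) (hc : c + c^-1 <= 2 + k / 2).
Local Notation w := (tree_weight a b).

(* The profile of ratio q is strictly superharmonic only at its center, by    *)
(* 1 - q; elsewhere the killing at rate l makes up for its subharmonicity.    *)
Lemma vertical_super (A B q l : R) v z :
  0 <= B <= A -> c <= q < 1 -> 0 <= l -> q + q^-1 <= 2 + l ->
  1 <= B * (c + c^-1 - 2 - l) -> 1 + 2 * B <= 2 * A * (1 - q) ->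
  A * (hat q v (z + 1) + hat q v (z - 1)) -
    B * (hat c v (z + 1) + hat c v (z - 1)) + hat c v z <=
  (2 + l) * (A * hat q v z - B * hat c v z).
Proof.
move=> /andP[B0 BA] /andP[cq q1] l0 ql HB HA.
have q0 : 0 < q := lt_le_trans c0 cq.
have [->|zv] := eqVneq z v.
  rewrite !hat_sum_at !hat_at !mulr1.
  have : 0 <= l * (A - B) by rewrite mulr_ge0// subr_ge0.
  have : 0 <= B * c by rewrite mulr_ge0// ltW.
  by move: HA; nra.
rewrite !hat_sum//; have Kq := hat_gt0 v z q0; have Kc := hat_gt0 v z c0.
set x := hat q v z in Kq *; set y := hat c v z in Kc *.
have : 0 <= A * x * (2 + l - (q + q^-1)).
  by rewrite !mulr_ge0 ?subr_ge0//; [apply: le_trans BA|apply: ltW].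
have : 0 <= (B * (c + c^-1 - 2 - l) - 1) * y.
  by rewrite mulr_ge0 ?subr_ge0// ltW.
by nra.
Qed.

Variables (N d : nat) (f : tree r N) (v : int).
Hypotheses (fd : (size f <= d)%N) (dN : (d < N)%N).
Local Notation e := (@tree_adj r N).

(** Half of the surplus k of the tree weight pays for the vertical growth c + 1/c - 2 <= k/2, the
    other half for the source at (f, v), whose coefficient is divided by the largest degree r + 3.
    At the leaves the defect is at most b^(N - d) / b times [hat c], and the second term of phi is
    the profile of [vertical_super], which has room for just such a source [hat c]. *)
Lemma cylinder_super (A B q l : R) :
  0 <= B <= A -> c <= q < 1 -> 0 <= l -> q + q^-1 <= 2 + l ->
  1 <= B * (c + c^-1 - 2 - l) -> 1 + 2 * B <= 2 * A * (1 - q) ->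
  let phi (x : cylinder (tree r N)) := w f x.1 * hat c v x.2 +
    b ^+ (N - d) / b * (A * hat q v x.2 - B * hat c v x.2) in
  forall x, (k / (2 * (r.+3)%:R)) * (x == (f, v))%:R + avg (cnb e) phi x <=
    (1 + l) * phi x.
Proof.
move=> HBA Hq l0 ql HB HA phi x.
have [/andP[B0 BA] /andP[cq q1]] := (HBA, Hq).
have q0 : 0 < q := lt_le_trans c0 cq.
have leaf_arith (W X E : R) : 0 <= W -> X <= E ->
    X + W * (2 + k / 2) <= (1 + 2) * W + E.
  move=> W0 XE; have : W * (k / 2) <= W by rewrite ler_piMr// ler_pdivrMr// mul1r.
  by lra.
case: x => y z; set E0 := b ^+ (N - d) / b.
have E00 : 0 < E0 by rewrite /E0 divr_gt0// exprn_gt0.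
have V := vertical_super v z HBA Hq l0 ql HB HA.
have Kc := hat_gt0 v z c0; have Kc1 : hat c v z <= 1 by apply: hat_le1; rewrite !ltW.
have Kqc : 0 <= A * hat q v z - B * hat c v z.
  rewrite subr_ge0 ler_pM ?(ltW Kc)//.
  by apply: lerXn2r; rewrite ?nnegrE ?(ltW c0) ?(ltW q0).
have ps := tree_weight_gt0 a0 b0 f y.
have Sc := sum_hat_le v z c0 (ltW c1).
set deg := size (cnb e (y, z)).
have degE : deg = (#|e y|).+2 by rewrite /deg size_cnb.
have deg0 : 0 < deg%:R :> R by rewrite degE ltr0n.
have degr : (deg <= r.+3)%N by rewrite degE !ltnS; apply: card_tree_adj_le.
rewrite -(ler_pM2r deg0) mulrDl {1}/avg mulfVK ?gt_eqF//.
rewrite sum_cnb /= big_split/= -big_distrl/= sumr_const.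
set T := \sum_(u | e y u) _; set h := #|e y|.
rewrite -/E0; set Kz := A * hat q v z - B * hat c v z in V Kqc *.
set src := k / (2 * r.+3%:R) * _ * deg%:R.
pose ind : R := ((y, z) == (f, v))%:R.
have srcE : src <= k / 2 * ind * hat c v z.
  rewrite /src /ind; case: eqP => [[_ ->]|_] /=; last by rewrite !(mulr0, mul0r).
  rewrite hat_at !mulr1 -ler_pdivlMr// invfM mulrA ler_pM2l ?divr_gt0//.
  by rewrite lef_pV2 ?posrE// ler_nat.
have horiz : T * hat c v z + w f y * (hat c v (z + 1) + hat c v (z - 1)) +
    k / 2 * ind * hat c v z <= (h%:R + 2) * w f y * hat c v z + E0 * hat c v z.
  have Sc' : w f y * (hat c v (z + 1) + hat c v (z - 1)) <= w f y * (2 + k / 2) * hat c v z.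
    rewrite -mulrA ler_pM2l//; apply: le_trans Sc _.
    by rewrite ler_wpM2r// ltW.
  suff : T + k / 2 * ind + w f y * (2 + k / 2) <= (h%:R + 2) * w f y + E0.
    by move=> /(ler_wpM2r (ltW Kc)); lra.
  have [yN|] := ltnP (size y) N.
    have := tree_weight_super a0 a1 b0 b1 h1 h2 f yN; rewrite -/T -/h => HT.
    have : k / 2 * ind <= k / 2 * w f y.
      rewrite ler_pM2l ?divr_gt0// /ind; case: eqP => [[-> _]|_] /=.
        by rewrite tree_weight_self.
      exact: ltW.
    by move: HT E00; lra.
  move=> Ny; have yN : size y = N by apply/eqP; rewrite eqn_leq size_bseq.
  have fN : (size f < N)%N := leq_ltn_trans fd dN.
  have -> : ind = 0.
    by rewrite /ind; case: eqP => // -[yf _]; move: fN; rewrite -yf yN ltnn.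
  have TE : T = w f y / b := tree_weight_leaf a b0 yN fN.
  have -> : h = 1%N by rewrite /h card_tree_adj yN ltnn (leq_ltn_trans _ fN).
  have wE : w f y / b <= E0.
    rewrite ler_pM2r ?invr_gt0//; apply: le_trans (tree_weight_leaf_le a0 a1 b0 b1 yN fN) _.
    by apply: ler_wiXn2l; rewrite ?(ltW b0) ?leq_sub2l.
  by rewrite TE mulr0 addr0 -[1%:R]/(1 : R); apply: leaf_arith; rewrite ?(ltW ps).
have Eh : E0 * (A * (hat q v (z + 1) + hat q v (z - 1)) -
    B * (hat c v (z + 1) + hat c v (z - 1)) + hat c v z) <= E0 * ((2 + l) * Kz).
  by rewrite ler_pM2l.
have pos : 0 <= l * (deg%:R * (w f y * hat c v z) + (h%:R + 1) * E0 * Kz).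
  apply: mulr_ge0 => //; apply: addr_ge0; apply: mulr_ge0 => //.
    by apply: mulr_ge0; apply: ltW.
  by apply: mulr_ge0; [apply: addr_ge0|apply: ltW].
rewrite -[_ *+ h]mulr_natl /phi /= -/E0 -/Kz.
have degR : deg%:R = h%:R + 2 :> R by rewrite degE -addn2 natrD.
rewrite degR in pos *.
set W := w f y in ps horiz pos *; set x1 := hat c v (z + 1) in horiz Eh *.
set x2 := hat c v (z - 1) in horiz Eh *; set x0 := hat c v z in horiz pos srcE Eh *.
set u1 := hat q v (z + 1) in Eh *; set u2 := hat q v (z - 1) in Eh *.
by lra.
Qed.

(** The time horizon is s^2, so killing at rate 2 / s^2 costs only a factor e^2. The first term is
    the decay around (f, v); the second is the cost of the leaves, where the vertical profile of
    ratio 1 - 1/s has size of order s. *)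
Lemma green_bound (s : nat) (B : R) n x :
  (2 <= s)%N -> c <= 1 - s%:R^-1 -> B * (c + c^-1 - 2) = 2 -> 0 <= B ->
  4 / s%:R ^+ 2 <= c + c^-1 - 2 -> (n < s ^ 2)%N ->
  green (cnb e) (fun y => (y == (f, v))%:R) n x <=
    (2 * (r.+3)%:R / k) * expR 2 *
    (w f x.1 * hat c v x.2 + b ^+ (N - d) / b * (s%:R * (1 + 2 * B))).
Proof.
move=> s2 cs HB B0 Hs ns.
have sR : 2 <= s%:R :> R by rewrite ler_nat.
have s0 : 0 < s%:R :> R by apply: lt_le_trans sR.
set A := s%:R * (1 + 2 * B); set q := 1 - s%:R^-1 in cs *.
pose l : R := 2 / s%:R ^+ 2.
have si : s%:R * s%:R^-1 = 1 :> R by rewrite mulfV ?gt_eqF.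
have BA : B <= A.
  rewrite /A; apply: (@le_trans _ _ (1 * (1 + 2 * B))); first by lra.
  by rewrite ler_wpM2r//; lra.
have q1 : q < 1 by rewrite /q ltrBlDr ltrDl invr_gt0.
have q0 : 0 < q := lt_le_trans c0 cs.
have l0 : 0 <= l by rewrite /l divr_ge0// exprn_ge0// ltW.
have ql : q + q^-1 <= 2 + l.
  have s1 : 0 < s%:R - 1 :> R by lra.
  have -> : q = (s%:R - 1) / s%:R by rewrite /q; field; rewrite gt_eqF.
  rewrite -subr_ge0 /l.
  have -> : 2 + 2 / s%:R ^+ 2 - ((s%:R - 1) / s%:R + ((s%:R - 1) / s%:R)^-1) =
    (s%:R - 2) / (s%:R ^+ 2 * (s%:R - 1)) :> R.
    by field; rewrite !gt_eqF.
  by rewrite divr_ge0 ?subr_ge0// mulr_ge0 ?(ltW s1)// exprn_ge0// ltW.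
(* The rate l is half of 4 / s^2, hence at most half of c + 1/c - 2; out of B (c + 1/c - 2) = 2 at
   least 1 remains. *)
have HB' : 1 <= B * (c + c^-1 - 2 - l).
  have -> : l = 4 / s%:R ^+ 2 / 2 by rewrite /l; field; rewrite gt_eqF.
  have : B * (4 / s%:R ^+ 2) <= B * (c + c^-1 - 2) by rewrite ler_wpM2l.
  by rewrite HB; lra.
have HA : 1 + 2 * B <= 2 * A * (1 - q).
  rewrite /A (_ : 1 - q = s%:R^-1); last by rewrite /q; ring.
  have -> : 2 * (s%:R * (1 + 2 * B)) / s%:R = 2 * (1 + 2 * B).
    by field; rewrite gt_eqF.
  by lra.
have HBA : 0 <= B <= A by rewrite B0.
have Hq : c <= q < 1 by rewrite cs.
have sup := cylinder_super HBA Hq l0 ql HB' HA.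
set phi := (fun _ => _) in sup.
have phi0 y : 0 <= phi y.
  rewrite /phi addr_ge0// mulr_ge0//.
  - by rewrite ltW// tree_weight_gt0.
  - by rewrite ltW// hat_gt0.
  - by rewrite divr_ge0 ?exprn_ge0 ?ltW.
  rewrite subr_ge0; apply: ler_pM => //; first exact: ltW (hat_gt0 _ _ c0).
  by apply: lerXn2r; rewrite ?nnegrE ?(ltW c0) ?(ltW q0).
set t := k / (2 * _) in sup.
have t0 : 0 < t by rewrite /t divr_gt0// mulr_gt0.
have s0' y : 0 <= t * (y == (f, v))%:R by rewrite mulr_ge0// ltW.
have := green_super n x l0 phi0 s0' sup.
rewrite greenZ => H.
have phix : phi x <= w f x.1 * hat c v x.2 + b ^+ (N - d) / b * A.
  rewrite /phi lerD2l; apply: ler_wpM2l; first by rewrite divr_ge0 ?exprn_ge0 ?(ltW b0).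
  have A0 : 0 <= A := le_trans B0 BA.
  have Hq1 : A * hat q v x.2 <= A.
    by rewrite ler_piMr//; apply: hat_le1; rewrite !ltW.
  have Hc0 : 0 <= B * hat c v x.2 by rewrite mulr_ge0// ltW// hat_gt0.
  by move: Hq1 Hc0; lra.
have el : (1 + l) ^+ n.+1 <= expR 2.
  apply: (@le_trans _ _ (expR l ^+ n.+1)).
    by rewrite lerXn2r ?nnegrE ?expR_ge0 ?addr_ge0// expR_ge1Dx.
  rewrite -expRM_natl ler_expR /l -natrX mulrA ler_pdivrMr ?ltr0n ?expn_gt0 ?(ltn_trans _ s2)//.
  by rewrite mulrC ler_pM2l// ler_nat.
have tE : 2 * (r.+3)%:R / k = t^-1 by rewrite /t invf_div.
rewrite tE -mulrA -ler_pdivrMl ?invr_gt0// invrK.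
apply: (le_trans H); rewrite ler_pM// exprn_ge0// addr_ge0//.
Qed.

End GreenBound.

(** * Probability of an early disconnection *)

Lemma tree_weight_le1 (R : realType) (r : nat) (a b : R) (f y : seq 'I_r) :
  0 < a -> a <= 1 -> 0 < b -> b <= 1 -> tree_weight a b f y <= 1.
Proof.
move=> a0 a1 b0 b1.
apply: (@le_trans _ _ (b ^+ (size y - minn (size f) (size y)))); last first.
  by rewrite exprn_ile1 ?(ltW b0).
apply: tree_weight_le => //; rewrite ?geq_minl ?geq_minr// => j /andP[mj jy].
apply/negP => /size_prefix; rewrite size_takel// leqNgt ltnS.
by move: mj; rewrite geq_min => /orP[->//|]; rewrite leqNgt jy.
Qed.

(** * The comb of words 0^j 1^k and its tips *)

Section Comb.
Variables (r N q l : nat) (o0 o1 : 'I_r).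
Hypothesis o01 : o0 != o1.
Hypothesis qlN : (q + l < N)%N.

Definition comb_word j k : seq 'I_r := nseq j o0 ++ nseq k o1.

(** [insub_bseq] falls back on the empty word when the word is longer than N, which does not occur
    for j <= q and k <= l. *)
Definition comb_vertex j k : tree r N := insub_bseq N (comb_word j k).

Definition comb : seq (tree r N) :=
  [seq comb_vertex j k | j <- iota 0 q, k <- iota 0 l.+1].

Lemma comb_vertexE j k : (j <= q)%N -> (k <= l)%N ->
  bseqval (comb_vertex j k) = comb_word j k.
Proof.
move=> jq kl; have sz : (size (comb_word j k) <= N)%N.
  by rewrite size_cat !size_nseq (leq_trans (leq_add jq kl))// ltnW.
by rewrite /comb_vertex /insub_bseq /insubd insubT.
Qed.

Lemma combP f : reflect (exists j k, [/\ (j < q)%N, (k <= l)%N & f = comb_vertex j k])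
  (f \in comb).
Proof.
apply: (iffP allpairsP) => [[[j k] [jq kl ->]]|[j [k [jq kl ->]]]].
  by exists j, k; move: jq kl; rewrite !mem_iota !add0n.
by exists (j, k); rewrite !mem_iota !add0n.
Qed.

Lemma comb_ancestor k f : f \in comb -> ancestor k f \in comb.
Proof.
move=> /combP[i [j [iq jl ->]]]; have iq' := ltnW iq; apply/combP.
have [ki|/ltnW ik] := leqP k i.
  exists k, 0%N; have kq := leq_ltn_trans ki iq; split => //.
  apply: val_inj; have kq' := ltnW kq; rewrite /= !comb_vertexE//.
  by rewrite /comb_word cats0 takel_cat ?size_nseq// take_nseq// (minn_idPl ki).
exists i, (minn (k - i) j); have ml := leq_trans (geq_minr (k - i) j) jl; split => //.
apply: val_inj; rewrite /= !comb_vertexE//.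
rewrite /comb_word take_cat size_nseq ltnNge ik/=; congr (_ ++ _).
have [h|h] := leqP (k - i) j; first by rewrite take_nseq.
by rewrite take_oversize ?size_nseq// ltnW.
Qed.

Lemma size_comb : size comb = (q * l.+1)%N.
Proof. by rewrite size_allpairs !size_iota. Qed.

Lemma comb_size_le f : f \in comb -> (size f <= q + l)%N.
Proof.
move=> /combP[i [j [iq jl ->]]].
by rewrite comb_vertexE ?(ltnW iq)// size_cat !size_nseq leq_add// ltnW.
Qed.

Lemma comb_tip j : (j < q)%N -> comb_vertex j l \in comb.
Proof. by move=> jq; apply/combP; exists j, l. Qed.

(** The two words part at position min(i, j), where the one with the shorter run of [o0] already
    reads [o1]. At least l letters of the tip i lie beyond that position. *)
Lemma comb_tip_weight (R : realType) (a b : R) i j :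
  0 < a -> a <= 1 -> 0 < b -> b <= 1 -> (0 < l)%N ->
  (i < q)%N -> (j < q)%N -> i != j ->
  tree_weight a b (comb_vertex j l) (comb_vertex i l) <= b ^+ l.
Proof.
move=> a0 a1 b0 b1 l0 iq jq ij.
rewrite !comb_vertexE ?(ltnW iq) ?(ltnW jq)//.
have nth_comb m k : nth o0 (comb_word m l) k = if (m <= k < m + l)%N then o1 else o0.
  rewrite nth_cat size_nseq !nth_nseq; case: (ltnP k m) => km; rewrite ?if_same//=.
  by rewrite ltn_subLR.
apply: (@le_trans _ _ (b ^+ (size (comb_word i l) - minn i j))); last first.
  apply: ler_wiXn2l; rewrite ?(ltW b0)// size_cat !size_nseq.
    rewrite leq_subRL ?leq_add2r ?geq_minl//.
  exact: leq_trans (geq_minl _ _) (leq_addr _ _).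
apply: tree_weight_le => //.
- by rewrite size_cat !size_nseq (leq_trans (geq_minr _ _))// leq_addr.
- by rewrite size_cat !size_nseq (leq_trans (geq_minl _ _))// leq_addr.
move=> k /andP[mk ki]; apply/negP => /prefixP[t E].
have := congr1 (fun s => nth o0 s (minn i j)) E.
rewrite /= nth_cat size_takel// ltnS mk nth_take ?ltnS// !nth_comb.
move: ij; rewrite neq_ltn => /orP[ij|ij].
  have il : (i < i + l)%N by rewrite -[X in (X < _)%N]addn0 ltn_add2l.
  rewrite (minn_idPl (ltnW ij)) leqnn il [(j <= i)%N]leqNgt ij/=.
  by move/eqP; rewrite (negbTE o01).
have jl : (j < j + l)%N by rewrite -[X in (X < _)%N]addn0 ltn_add2l.
rewrite (minn_idPr (ltnW ij)) leqnn jl [(i <= j)%N]leqNgt ij/=.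
by move/esym/eqP; rewrite (negbTE o01).
Qed.

End Comb.

Lemma window_index (i : int) (h : nat) z : i * h%:Z <= z < (i + 2) * h%:Z ->
  exists2 k, (k < 2 * h)%N & z = i * h%:Z + k%:Z.
Proof. by move=> zi; exists (absz (z - i * h%:Z)%R); lia. Qed.

Lemma distinct_levels_far i j L : i != j ->
  (L <= absz ((i * L)%N%:Z - (j * L)%N%:Z)%R)%N.
Proof.
rewrite neq_ltn => /orP[ij|ij].
  have : (i.+1 * L <= j * L)%N by rewrite leq_mul2r ij orbT.
  by rewrite mulSn; lia.
have : (j.+1 * L <= i * L)%N by rewrite leq_mul2r ij orbT.
by rewrite mulSn; lia.
Qed.

(** A walk of n steps changes height by at most n, so the windows it meets belong to a list of 2n +
    5 known in advance. This makes a union bound over windows possible. *)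
Lemma near_window_index (h n : nat) (i z y : int) : (0 < h)%N ->
  i * h%:Z <= y < (i + 2) * h%:Z -> `|y - z| <= n%:Z ->
  exists2 k, (k < 2 * n + 5)%N & i = (z %/ h%:Z)%Z + k%:Z - n.+2%:Z.
Proof.
move=> h0 yi close; set m := (z %/ _)%Z.
have zm := divz_eq z h%:Z; rewrite -/m in zm.
have mod0 : 0 <= (z %% h%:Z)%Z by apply: modz_ge0; lia.
have modh : (z %% h%:Z)%Z < h%:Z by apply: ltz_pmod; lia.
have nh : n%:Z <= n%:Z * h%:Z by rewrite ler_peMr//; lia.
have i1 : i <= m + n%:Z.
  rewrite leNgt; apply/negP => im; move: yi => /andP[yi _].
  have : (m + n%:Z + 1) * h%:Z <= i * h%:Z by rewrite ler_wpM2r//; lia.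
  by move: close zm modh yi; rewrite !mulrDl; lia.
have i2 : m - n%:Z - 1 <= i.
  rewrite leNgt; apply/negP => im; move: yi => /andP[_ yi].
  have : (i + 2) * h%:Z <= (m - n%:Z) * h%:Z by rewrite ler_wpM2r//; lia.
  by move: close zm mod0 yi; rewrite mulrBl; lia.
by exists (absz (i - m + n.+2%:Z)%R); lia.
Qed.

Section LowerBound.
Variables (R : realType) (r N q l L : nat) (o0 o1 : 'I_r) (a b c D tau eta : R).
Hypothesis o01 : o0 != o1.
Hypotheses (qlN : (q + l < N)%N) (q0 : (0 < q)%N) (l0 : (0 < l)%N) (L0 : (0 < L)%N).
Hypotheses (a0 : 0 < a) (a1 : a <= 1) (b0 : 0 < b) (b1 : b <= 1).
Hypotheses (c0 : 0 < c) (c1 : c < 1) (D0 : 0 <= D) (tau0 : 0 <= tau).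
Variable n : nat.
Local Notation e := (@tree_adj r N).
Local Notation T := (cylinder (tree r N)).
Local Notation nb := (cnb e).
Hypothesis green_bd : forall (f : tree r N) (v : int) (x : T), (size f <= q + l)%N ->
  green nb (fun y => (y == (f, v))%:R) n x <=
    D * (tree_weight a b f x.1 * hat c v x.2 + tau).
Hypotheses (eta1 : c ^+ L + tau <= eta) (eta2 : b ^+ l + tau <= eta).

(** With this height, q levels at spacing L fit into one slab. *)
Let H := (q * L)%N.
Local Notation F := (comb N q l o0 o1).

Definition level_hit (i : int) (j : nat) : pred T :=
  fun x => (x.1 \in F) && (x.2 == i * H%:Z + (j * L)%N%:Z).

Definition tip_hit (i : int) (j : nat) : pred T :=
  fun x => (x.1 == comb_vertex N o0 o1 j l) && (i * H%:Z <= x.2 < (i + 2) * H%:Z).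

(** If every window kept one unvisited level and one unvisited tip line, these would be the free
    levels and columns of [free_levels_not_disconnects]. *)
Lemma disconnects_hits (S : set T) (p : seq T) : S `<=` [set` p] ->
  disconnects e S -> exists i,
    all (fun j => has (level_hit i j) p) (iota 0 q) ||
    all (fun j => has (tip_hit i j) p) (iota 0 q).
Proof.
move=> Sp dS; apply: contrapT => noi.
have lev i : {j | (j < q)%N /\ ~~ has (level_hit i j) p}.
  apply: cid; apply: contrapT => nj; apply: noi; exists i; apply/orP; left.
  apply/allP => j; rewrite mem_iota add0n /= => jq; apply: contrapT => /negP h.
  by apply: nj; exists j.
have tip i : exists j, (j < q)%N /\ ~~ has (tip_hit i j) p.
  apply: contrapT => nj; apply: noi; exists i; apply/orP; right.
  apply/allP => j; rewrite mem_iota add0n /= => jq; apply: contrapT => /negP h.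
  by apply: nj; exists j.
have H0 : (0 < H)%N by rewrite muln_gt0 q0.
apply: (@free_levels_not_disconnects r N S (mem F) H
  (fun i => i * H%:Z + (sval (lev i) * L)%N%:Z)) dS => //.
- by move=> k f; apply: comb_ancestor.
- move=> i; case: (lev i) => j [jq _] /=; rewrite lerDl lez_nat leq0n/= mulrDl mul1r.
  by rewrite ltrD2l ltz_nat ltn_mul2r L0.
- move=> i f fF /Sp /= fp; case: (lev i) fp => j [_ /hasPn nh] /= fp.
  by have := nh _ fp; rewrite /level_hit /= eqxx andbT => /negP; apply.
- move=> i; have [j [jq /hasPn nh]] := tip i; exists (comb_vertex N o0 o1 j l).
    exact: comb_tip.
  move=> z zi /Sp /= fp.
  by have := nh _ fp; rewrite /tip_hit /= eqxx zi.
Qed.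

(** Dominates both the q (l + 1) points of the comb on one level and the 2H points above one tip in
    a window. *)
Let K : R := (q * l.+1 + 2 * H)%N%:R.

Lemma green_level_le i j x : green nb (fun y => (level_hit i j y)%:R) n x <=
  K * D * (hat c (i * H%:Z + (j * L)%N%:Z) x.2 + tau).
Proof.
set v := i * H%:Z + _.
have Kv := hat_gt0 v x.2 c0.
apply: (@le_trans _ _ (green nb (fun y => \sum_(f <- F) (y == (f, v))%:R) n x)).
  apply: green_le => -[g z]; rewrite /level_hit /=.
  case: (boolP (g \in F)) => gF /=; last by rewrite sumr_ge0.
  rewrite (big_rem g gF)/= -pair_eqE /= eqxx /= lerDl sumr_ge0//.
rewrite green_sum; apply: (@le_trans _ _ (\sum_(f <- F) D * (hat c v x.2 + tau))).
  rewrite !big_seq; apply: ler_sum => f fF.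
  apply: le_trans (green_bd v x (comb_size_le qlN fF)) _.
  rewrite ler_wpM2l// lerD2r ler_piMl ?(ltW Kv)//.
  exact: tree_weight_le1.
rewrite big_const_seq count_predT iter_addr_0 size_comb -[_ *+ _]mulr_natl mulrA.
rewrite ler_wpM2r ?addr_ge0 ?(ltW Kv)// ler_wpM2r// ler_nat leq_addr.
by [].
Qed.

Lemma green_tip_le i j x : (j < q)%N ->
  green nb (fun y => (tip_hit i j y)%:R) n x <=
  K * D * (tree_weight a b (comb_vertex N o0 o1 j l) x.1 + tau).
Proof.
move=> jq; set f := comb_vertex _ _ _ _ _.
have w0 := tree_weight_gt0 a0 b0 f x.1.
pose vs := [seq i * H%:Z + k%:Z | k <- iota 0 (2 * H)].
apply: (@le_trans _ _ (green nb (fun y => \sum_(v <- vs) (y == (f, v))%:R) n x)).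
  apply: green_le => -[g z]; rewrite /tip_hit /= -/f.
  case: eqP => [->|_] /=; last by rewrite sumr_ge0.
  case: (boolP (_ <= _ < _)) => zi /=; last by rewrite sumr_ge0.
  have zv : z \in vs.
    have [k kH ->] := window_index zi; apply/mapP; exists k => //.
    by rewrite mem_iota add0n.
  by rewrite (big_rem z zv)/= eqxx lerDl sumr_ge0.
rewrite green_sum.
apply: (@le_trans _ _ (\sum_(v <- vs) D * (tree_weight a b f x.1 + tau))).
  apply: ler_sum => v _.
  have fF : f \in F by apply: comb_tip.
  apply: le_trans (green_bd v x (comb_size_le qlN fF)) _.
  rewrite ler_wpM2l// lerD2r ler_piMr ?(ltW w0)//.
  by apply: hat_le1; rewrite !ltW.
rewrite big_const_seq count_predT iter_addr_0 size_map size_iota -[_ *+ _]mulr_natl mulrA.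
rewrite ler_wpM2r ?addr_ge0 ?(ltW w0)// ler_wpM2r// ler_nat leq_addl.
by [].
Qed.

(** The bound of [expect_hit_all]: the first set hit costs K D (1 + tau), summed over the q sets,
    and each later one K D eta. *)
Let hits_bound : R := q%:R * (K * D * (1 + tau)) * ((q.-1)`!%:R * (K * D * eta) ^+ q.-1).

Lemma eta_ge0 : 0 <= eta.
Proof. by apply: le_trans eta1; rewrite addr_ge0// exprn_ge0// ltW. Qed.

Lemma expect_hits (A : nat -> pred T) x :
  (forall j y, (j < q)%N -> green nb (fun z => (A j z)%:R) n y <= K * D * (1 + tau)) ->
  (forall i j y, (i < q)%N -> (j < q)%N -> i != j -> A i y ->
     green nb (fun z => (A j z)%:R) n y <= K * D * eta) ->
  expect nb n x (fun p => (all (fun j => has (A j) p) (iota 0 q))%:R) <= hits_bound.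
Proof.
move=> HA HA'; have nb0 : forall y, nb y != [::] by exact: cnb_neq0.
have KD0 : 0 <= K * D by rewrite mulr_ge0.
have rho0 : 0 <= K * D * eta by rewrite mulr_ge0// eta_ge0.
have pw i j y : i \in iota 0 q -> j \in iota 0 q -> i != j -> A i y ->
    green nb (fun z => (A j z)%:R) n y <= K * D * eta.
  by rewrite !mem_iota !add0n /=; apply: HA'.
apply: (le_trans (expect_hit_all nb0 x rho0 pw (iota_uniq 0 q) (leqnn n))).
have EI : iota 0 q = 0%N :: iota 1 q.-1 by rewrite -[q in LHS](prednK q0).
rewrite {1}EI size_iota /hits_bound.
apply: ler_wpM2r; first by rewrite mulr_ge0// exprn_ge0.
apply: (@le_trans _ _ (\sum_(j <- iota 0 q) (K * D * (1 + tau)))).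
  rewrite [leLHS]big_seq [leRHS]big_seq; apply: ler_sum => j.
  by rewrite mem_iota add0n /=; apply: HA.
by rewrite big_const_seq count_predT iter_addr_0 size_iota -[_ *+ q]mulr_natl.
Qed.

Lemma expect_level_hits i x : expect nb n x
  (fun p => (all (fun j => has (level_hit i j) p) (iota 0 q))%:R) <= hits_bound.
Proof.
have KD0 : 0 <= K * D by rewrite mulr_ge0.
apply: expect_hits => [j y jq|i' j y iq jq ij].
  apply: (le_trans (green_level_le i j y)); rewrite ler_wpM2l// lerD2r.
  by apply: hat_le1; rewrite !ltW.
move=> /andP[_ /eqP yE]; apply: (le_trans (green_level_le i j y)).
rewrite ler_wpM2l//; apply: le_trans eta1; rewrite lerD2r /hat yE.
apply: ler_wiXn2l; rewrite ?ltW//.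
by rewrite opprD addrACA subrr add0r; apply: distinct_levels_far.
Qed.

Lemma expect_tip_hits i x : expect nb n x
  (fun p => (all (fun j => has (tip_hit i j) p) (iota 0 q))%:R) <= hits_bound.
Proof.
have KD0 : 0 <= K * D by rewrite mulr_ge0.
apply: expect_hits => [j y jq|i' j y iq jq ij].
  apply: (le_trans (green_tip_le i y jq)); rewrite ler_wpM2l// lerD2r.
  exact: tree_weight_le1.
move=> /andP[/eqP yE _]; apply: (le_trans (green_tip_le i y jq)).
rewrite ler_wpM2l//; apply: le_trans eta2; rewrite lerD2r yE.
by apply: (@comb_tip_weight r N q).
Qed.

Lemma disconnection_prob_le x :
  expect nb n x (fun p => `[< exists k, disconnects e [set` take k p] >]%:R) <=
    (2 * n + 5)%N%:R * (2 * hits_bound).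
Proof.
have nb0 : forall y, nb y != [::] by exact: cnb_neq0.
have H0 : (0 < H)%N by rewrite muln_gt0 q0.
pose m := (x.2 %/ H%:Z)%Z.
pose I := [seq m + k%:Z - n.+2%:Z | k <- iota 0 (2 * n + 5)].
pose hitL i (p : seq T) := all (fun j => has (level_hit i j) p) (iota 0 q).
pose hitT i (p : seq T) := all (fun j => has (tip_hit i j) p) (iota 0 q).
apply: (@le_trans _ _ (expect nb n x
    (fun p => \sum_(i <- I) ((hitL i p)%:R + (hitT i p)%:R)))).
  apply: expect_le => p xp sp; case: asboolP => [[k dk]|_] /=; last first.
    by rewrite sumr_ge0// => i _; rewrite addr_ge0.
  have [i hi] : exists i, hitL i (x :: p) || hitT i (x :: p).
    by apply: disconnects_hits dk => y /mem_take.
  have iI : i \in I.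
    (* The set of index 0, present since q > 0, has been visited, and this locates the window near
       the path. *)
    have [y yp yi] : exists2 y, y \in x :: p & i * H%:Z <= y.2 < (i + 2) * H%:Z.
      move: hi => /orP[] /allP /(_ 0%N); rewrite mem_iota add0n q0 => /(_ isT) /hasP[y yp].
        move=> /andP[_ /eqP yE]; exists y => //; rewrite yE mul0n addr0 lexx/=.
        by rewrite mulrDl ltrDl pmulr_rgt0// ltz_nat.
      by move=> /andP[_ yi]; exists y.
    have := walk_close xp yp.
    rewrite sp => close.
    have [t tn ->] := near_window_index H0 yi close; apply/mapP; exists t => //.
    by rewrite mem_iota add0n.
  apply: (@le_trans _ _ ((hitL i (x :: p))%:R + (hitT i (x :: p))%:R)).
    by move: hi; case: (hitL _ _); case: (hitT _ _) => //= _; rewrite ?lerDl ?addr0 ?add0r.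
  by rewrite (big_rem i iI)/= lerDl sumr_ge0// => j _; rewrite addr_ge0.
rewrite expect_sum//; apply: (@le_trans _ _ (\sum_(i <- I) (2 * hits_bound))).
  apply: ler_sum => i _; rewrite expectD mulr_natl mulr2n lerD//.
    exact: expect_level_hits.
  exact: expect_tip_hits.
by rewrite big_const_seq count_predT iter_addr_0 size_map size_iota -[_ *+ _]mulr_natl.
Qed.

End LowerBound.

(** * Probability of a late disconnection *)

Section UpperBound.
Variables (R : realType) (r N : nat).
Hypothesis N0 : (0 < N)%N.
Local Notation e := (@tree_adj r N).
Local Notation T := (cylinder (tree r N)).
Local Notation nb := (cnb e).
Local Notation card := #|{: tree r N}|.

Lemma card_tree_gt0 : (0 < card)%N.
Proof. by apply/card_gt0P; exists (tree_root r N). Qed.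

Lemma level_path (z : int) (g h : tree r N) : exists p : seq T,
  [/\ path (fun u v => v \in nb u) (g, z) p, last (g, z) p = (h, z) &
      (size p <= 2 * N)%N].
Proof.
have adj (f : tree r N) k : (k < size f)%N ->
    cyl_adj e (ancestor k f, z) (ancestor k.+1 f, z).
  by move=> kf; rewrite /cyl_adj /= eqxx tree_adj_ancestor ?orbT.
have root (f : tree r N) : ancestor 0 f = tree_root r N.
  by apply: val_inj; rewrite /= take0.
have full (f : tree r N) : ancestor (size f) f = f.
  by apply: val_inj; rewrite /= take_size.
have up k : (k <= size g)%N -> exists p : seq T,
    [/\ path (fun u v => v \in nb u) (ancestor k g, z) p,
        last (ancestor k g, z) p = (tree_root r N, z) & size p = k].
  elim: k => [_|k IHk kg]; first by exists [::]; rewrite root.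
  have [p [pp lp sp]] := IHk (ltnW kg).
  exists ((ancestor k g, z) :: p); rewrite /= lp sp; split => //.
  by rewrite pp andbT mem_cnb cyl_adj_sym ?adj//; apply: tree_adj_sym.
have down k : (k <= size h)%N -> exists p : seq T,
    [/\ path (fun u v => v \in nb u) (tree_root r N, z) p,
        last (tree_root r N, z) p = (ancestor k h, z) & size p = k].
  elim: k => [_|k IHk kg]; first by exists [::]; rewrite root.
  have [p [pp lp sp]] := IHk (ltnW kg).
  exists (rcons p (ancestor k.+1 h, z)); rewrite rcons_path last_rcons size_rcons sp.
  by split => //; rewrite pp lp mem_cnb adj.
have [p [pp lp sp]] := up _ (leqnn _); have [p' [pp' lp' sp']] := down _ (leqnn _).
rewrite !full in pp lp pp' lp'; exists (p ++ p'); split.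
- by rewrite cat_path pp lp.
- by rewrite last_cat lp.
- by rewrite size_cat sp sp' mul2n -addnn leq_add// size_bseq.
Qed.

(** The bound of [kgreen_path_le] for a path of length at most 2N inside a level of total degree at
    most (r + 3) |G|. *)
Definition visit_bound : R := (2 * N * (r.+3 * card))%N%:R.

Lemma visit_bound_ge1 : 1 <= visit_bound.
Proof. by rewrite ler1n !muln_gt0 N0 card_tree_gt0. Qed.

Lemma kgreen_level_le (z : int) (h : tree r N) n (x : T) : x.2 = z ->
  kgreen nb (h, z) (fun y => (y.2 == z)%:R) n x <= visit_bound.
Proof.
case: x => g z' /= ->.
pose Lv : seq T := [seq (f, z) | f <- enum {: tree r N}].
have -> : (fun y : T => (y.2 == z)%:R) = (fun y => \sum_(w <- Lv) (y == w)%:R) :> (T -> R).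
  apply/funext => -[f z1] /=; rewrite big_map big_enum /=.
  under eq_bigr do rewrite -pair_eqE /= -mulnb natrM.
  rewrite -big_distrl /= (bigD1 f)//= eqxx big1 ?addr0 ?mul1r// => i /negbTE fi.
  by rewrite eq_sym fi.
have [p [pp lp sp]] := level_path z g h.
have H := kgreen_path_le R (@cnb_neq0 _ e) (@cnb_uniq _ e)
  (cnb_sym (@tree_adj_sym r N)) Lv n pp lp.
apply: le_trans; first exact: H.
rewrite /visit_bound natrM; apply: ler_pM => //; first by rewrite sumr_ge0.
  by rewrite ler_nat.
apply: (@le_trans _ _ (\sum_(w <- Lv) (r.+3)%:R)).
  apply: ler_sum => w _; rewrite ler_nat size_cnb !ltnS.
  exact: card_tree_adj_le.
by rewrite big_const_seq count_predT iter_addr_0 size_map -cardE -[_ *+ _]mulr_natr -natrM.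
Qed.

(** Markov's inequality for the exponential moment of [expect_exp_visits], which is at most 1 + M /
    M = 2. *)
Lemma expect_avoid_le (x : T) (h : tree r N) n m :
  expect nb n x (fun p => ((m <= count (fun y => y.2 == x.2) p)%N &&
      ((h, x.2) \notin p))%:R) <=
    2 / (1 + (2 * visit_bound)^-1) ^+ m.
Proof.
set M := visit_bound; have M1 : 1 <= M := visit_bound_ge1.
have M0 : 0 < M := lt_le_trans ltr01 M1.
set gm := 1 + _; have gm1 : 1 <= gm by rewrite lerDl invr_ge0 mulr_ge0// ltW.
have gm0 : 0 < gm := lt_le_trans ltr01 gm1.
rewrite ler_pdivlMr ?exprn_gt0// mulrC -expectZ.
pose L : pred T := fun y => y.2 == x.2.
have HL k y : L y -> kgreen nb (h, x.2) (fun z => (L z)%:R) k y <= M.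
  by move=> /eqP Ly; apply: kgreen_level_le.
have := expect_exp_visits (@cnb_neq0 _ e) (L := L) (a := (h, x.2)) n x M1 HL.
set E := expect _ _ _ _ => HE.
apply: (@le_trans _ _ E).
  apply: expect_le => p _ _; case: (_ \notin _); last by rewrite andbF !mulr0.
  rewrite andbT mulr1; case: (leqP m _) => mc; last by rewrite mulr0 exprn_ge0// ltW.
  by rewrite mulr1 ler_weXn2l.
apply: (le_trans HE); rewrite -[leRHS]/(1 + 1) lerD2l mulrC ler_pdivrMr// mul1r.
by apply: HL; rewrite /L.
Qed.

Lemma avg_level (F : int -> R) (x : T) :
  avg nb (fun y => F y.2) x * (#|e x.1|.+2)%:R =
  F (x.2 + 1) + F (x.2 - 1) + #|e x.1|%:R * F x.2.
Proof.
rewrite /avg size_cnb mulfVK ?pnatr_eq0//.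
by rewrite sum_cnb /= sumr_const -[_ *+ _]mulr_natl.
Qed.

(** Degrees are at most r + 3; the extra unit absorbs the second-order term in the discount. *)
Definition level_rate (s : nat) : R := ((r.+4)%:R * s%:R ^+ 2)^-1.

(** The subsolution is V = b^|height difference| with b = 1 - 1/s: under a discount of order s^-2
    per step, each visit costs a factor theta >= 1 - 2/s, and 1 - theta^m <= m (1 - theta). *)
Lemma expect_few_level_visits (x : T) (s : nat) n m : (2 <= s)%N ->
  expect nb n x (fun p => (count (fun y => y.2 == x.2) p < m)%:R) <=
    2 * m%:R / s%:R + (1 - level_rate s) ^+ n.
Proof.
move=> s2; pose l := level_rate s; rewrite -/l; have sR : 2 <= s%:R :> R by rewrite ler_nat.
have s0 : 0 < s%:R :> R by apply: lt_le_trans sR.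
set S : R := s%:R in sR s0 *; pose b : R := 1 - S^-1.
have Si : 0 < S^-1 by rewrite invr_gt0.
have Si2 : S^-1 <= 2^-1 by rewrite lef_pV2 ?posrE.
have b0 : 0 < b by rewrite /b; lra.
have b1 : b <= 1 by rewrite /b; lra.
have r4 : 4 <= (r.+4)%:R :> R by rewrite ler_nat.
have l0 : 0 < l by rewrite /l /level_rate -/S invr_gt0 mulr_gt0 ?exprn_gt0.
have lS : l <= S^-1.
  rewrite /l /level_rate -/S lef_pV2 ?posrE ?mulr_gt0 ?exprn_gt0//.
  apply: (@le_trans _ _ (1 * (1 * S))); first by rewrite !mul1r.
  by rewrite expr2; apply: ler_pM => //; try lra; apply: ler_wpM2r; lra.
have z0 : 0 < 1 - l by lra.
pose th := (1 - l) * b.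
have th0 : 0 <= th by rewrite /th mulr_ge0// ltW.
have th1 : th <= 1 by rewrite /th mulr_ile1//; lra.
pose V (y : T) := hat b x.2 y.2.
have dg (y : T) : 0 < (#|e y.1|.+2)%:R :> R by [].
have dgE (y : T) : (#|e y.1|.+2)%:R = #|e y.1|%:R + 2 :> R by rewrite -addn2 natrD.
have dgr (y : T) : #|e y.1|%:R + 2 <= (r.+3)%:R :> R.
  by rewrite -dgE ler_nat !ltnS card_tree_adj_le.
have bE : b + b^-1 = 2 + (S * (S - 1))^-1.
  rewrite /b; field; rewrite !gt_eqF//; lra.
have VL y : y.2 != x.2 -> V y <= (1 - l) * avg nb V y.
  move=> yx; rewrite -(ler_pM2r (dg y)) -mulrA (avg_level (hat b x.2)).
  rewrite hat_sum// /V dgE; have K0 := hat_gt0 x.2 y.2 b0.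
  set k := hat _ _ _ in K0 *; have hr := dgr y; set h := #|_|%:R in hr *.
  have h0 : 0 <= h by [].
  rewrite -mulrDl [leRHS]mulrA [leLHS]mulrC ler_pM2r// bE.
  have rE : (r.+4)%:R = (r.+3)%:R + 1 :> R by rewrite -natr1.
  set r3 := (r.+3)%:R in hr rE *.
  have u0 : 0 < (S ^+ 2)^-1 by rewrite invr_gt0 exprn_gt0.
  have uv : (S ^+ 2)^-1 <= (S * (S - 1))^-1.
    rewrite lef_pV2 ?posrE ?exprn_gt0 ?mulr_gt0//; first by rewrite expr2 ler_pM2l//; lra.
    by lra.
  have u1 : (S ^+ 2)^-1 <= 1 by rewrite invf_le1 ?exprn_gt0// exprn_ege1//; lra.
  set u := (S ^+ 2)^-1 in u0 uv u1; set v := (_ * _)^-1 in uv *.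
  have lE : l * (r3 + 1) = u by rewrite /l /level_rate -/S -rE invfM mulrAC mulVf ?mul1r// gt_eqF//; lra.
  have hl : l * (h + 2) + l <= u.
    have : l * (h + 2) <= l * r3 by rewrite ler_pM2l.
    by move: lE; lra.
  have : v * (1 - l) >= u * (1 - l) by rewrite ler_pM2r.
  have : u * l <= l by rewrite ler_piMl// ltW.
  lra.
have VL' y : y.2 == x.2 -> th * V y <= (1 - l) * avg nb V y.
  move=> /eqP yx; rewrite /th -mulrA ler_pM2l// -(ler_pM2r (dg y)).
  rewrite (avg_level (hat b x.2)) /V yx hat_sum_at hat_at !mulr1 dgE.
  have h0 : 0 <= #|e y.1|%:R :> R by [].
  have : b * #|e y.1|%:R <= #|e y.1|%:R by rewrite ler_piMl.
  lra.
have := expect_few_visits (@cnb_neq0 _ e) (L := fun y => y.2 == x.2) (V := V)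
  (theta := th) (zeta := 1 - l) m n x.
rewrite th0 th1 z0 => /(_ isT); set E := expect _ _ _ _ => H.
have {H} : E <= 1 - th ^+ m * V x + (1 - l) ^+ n.
  apply: H; [lra| |exact: VL|exact: VL'].
  by move=> y; apply: hat_le1; rewrite b1 ltW.
move=> H; apply: (le_trans H); rewrite lerD2r /V hat_at mulr1.
have bern : forall k, 1 - th ^+ k <= k%:R * (1 - th).
  elim=> [|k IHk]; first by rewrite expr0 subrr mul0r.
  have : th ^+ k <= 1 by rewrite exprn_ile1.
  have : 0 <= th ^+ k by rewrite exprn_ge0.
  rewrite exprS -natr1; move: IHk th0 th1; nra.
apply: (le_trans (bern m)); rewrite [2 * _]mulrC -mulrA ler_wpM2l//.
rewrite /th /b; have : 0 <= l * S^-1 by rewrite mulr_ge0 ?ltW.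
lra.
Qed.

Lemma not_cover_prob_le (x : T) (s : nat) n m : (2 <= s)%N ->
  expect nb n x (fun p => `[< ~ forall g, (g, x.2) \in p >]%:R) <=
    2 * m%:R / s%:R + (1 - level_rate s) ^+ n +
    card%:R * (2 / (1 + (2 * visit_bound)^-1) ^+ m).
Proof.
move=> s2.
apply: (@le_trans _ _ (expect nb n x (fun p =>
    (count (fun y => y.2 == x.2) p < m)%:R +
    \sum_(h <- enum {: tree r N}) ((m <= count (fun y => y.2 == x.2) p)%N &&
      ((h, x.2) \notin p))%:R))).
  apply: expect_le => p _ _; case: asboolP => [nc|_] /=; last first.
    by rewrite addr_ge0// sumr_ge0.
  case: (ltnP _ m) => cm; first by rewrite lerDl sumr_ge0.
  have /existsNP[g /negP gp] := nc.
  rewrite add0r (big_rem g) ?mem_enum//= gp lerDl sumr_ge0//.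
rewrite expectD expect_sum//.
rewrite lerD//; first exact: expect_few_level_visits.
apply: (@le_trans _ _ (\sum_(h <- enum {: tree r N})
    (2 / (1 + (2 * visit_bound)^-1) ^+ m))).
  by apply: ler_sum => h _; apply: expect_avoid_le.
by rewrite big_const_seq count_predT iter_addr_0 -cardE -[_ *+ _]mulr_natl.
Qed.

End UpperBound.

(** * Asymptotics *)

Lemma card_tree_ge (r N : nat) : (r ^ N <= #|{: tree r N}|)%N.
Proof. by rewrite card_bseq card_ord big_ord_recr /= leq_addl. Qed.

Lemma card_tree_le (r N : nat) : (2 <= r)%N -> (#|{: tree r N}| <= 2 * r ^ N)%N.
Proof.
move=> r2; rewrite card_bseq card_ord; elim: N => [|N IHN].
  by rewrite big_ord1 expn0.
rewrite big_ord_recr /= mul2n -addnn leq_add2r (leq_trans IHN)// expnS.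
by rewrite leq_mul2r r2 orbT.
Qed.

Section Exponentials.
Variable R : realType.
Implicit Types x y : R.

Lemma exp_le_eventually x y : 0 <= x < 1 -> 0 < y -> exists m, forall n, (m <= n)%N -> x ^+ n <= y.
Proof.
move=> /andP[x0 x1] y0.
have : (x ^+ n) @[n --> \oo] --> (0 : R) by apply: cvg_expr; rewrite ger0_norm.
move=> /cvgrPdist_le /(_ y y0)[m _ H]; exists m => n mn.
by have := H n mn; rewrite sub0r normrN ger0_norm// exprn_ge0.
Qed.

Lemma exp_ge_eventually x y : 1 < x -> exists m, forall n, (m <= n)%N -> y <= x ^+ n.
Proof.
move=> x1; have x0 : 0 < x := lt_trans ltr01 x1.
have xi : 0 <= x^-1 < 1 by rewrite invr_ge0 ltW//= invf_lt1.
have yi : 0 < (1 + `|y|)^-1 by rewrite invr_gt0 ltr_pwDl.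
have [m H] := exp_le_eventually xi yi.
exists m => n /H; rewrite exprVn lef_pV2 ?posrE ?exprn_gt0// ?ltr_pwDl//.
by apply: le_trans; rewrite (le_trans (ler_norm y))// lerDr.
Qed.

(** (n + 1) x^n is at most the geometric sum 1 + x + ... + x^n. *)
Lemma natmul_exp_le x n : 0 <= x < 1 -> n.+1%:R * x ^+ n <= (1 - x)^-1.
Proof.
move=> /andP[x0 x1].
have H : n.+1%:R * x ^+ n * (1 - x) <= 1 - x ^+ n.+1.
  elim: n => [|n IHn]; first by rewrite expr0 expr1; lra.
  have xn : 0 <= x ^+ n.+1 by rewrite exprn_ge0.
  have : x * (n.+1%:R * x ^+ n * (1 - x)) <= x * (1 - x ^+ n.+1) by rewrite ler_wpM2l.
  rewrite -[n.+2%:R]natr1 [x ^+ n.+2]exprS.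
  have -> : x * (n.+1%:R * x ^+ n * (1 - x)) = n.+1%:R * x ^+ n.+1 * (1 - x).
    by rewrite exprS; ring.
  have : 0 <= (1 - x) * (1 - x ^+ n.+1).
    by rewrite mulr_ge0 ?subr_ge0 ?exprn_ile1 ?(ltW x1).
  by lra.
rewrite -ler_pdivlMr ?subr_gt0// in H; apply: (le_trans H).
rewrite -[leRHS]mul1r; apply: ler_wpM2r; first by rewrite invr_ge0 subr_ge0 ltW.
by rewrite gerBl exprn_ge0.
Qed.

End Exponentials.

Lemma hit_count_le q l : (q * l.+1 + 2 * (q * l) <= 3 * q * l.+1)%N.
Proof. by lia. Qed.

(** The teeth take one part in k + 2 of the depth, so the leaves stay about (k + 1) l below the
    comb. *)
Lemma depth_split (N k q l1 l : nat) : l = (N %/ k.+2)%N ->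
  (k.+2 * (l1 + q.+1) <= N)%N ->
  [/\ (l1 + q.+1 <= l)%N, (q + l < N)%N, (N <= k.+2 + k.+2 * l)%N &
      (k.+1 * l <= N - (q + l) + q)%N].
Proof.
move=> lE kN; have NE := divn_eq N k.+2; rewrite -lE in NE.
have rem : (N %% k.+2 < k.+2)%N by rewrite ltn_mod.
have ql : (l1 + q.+1 <= l)%N by rewrite lE leq_divRL// mulnC.
have kl : (l * k.+2 = l + k.+1 * l)%N by rewrite mulnC mulSn.
have kl' : (l <= k.+1 * l)%N by rewrite leq_pmull.
by split; lia.
Qed.

(** * Choice of constants for the lower bound *)

Section LowerAsymptotics.
Variables (R : realType) (r : nat) (mu C : R) (s : nat -> nat).
Hypotheses (r2 : (2 <= r)%N) (mu1 : 1 < mu) (mur : mu < r%:R) (C0 : 0 < C).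
Hypothesis s_le : forall N, (s N)%:R <= C * mu ^+ N.
Hypothesis s_large : forall m, exists N0, forall N, (N0 <= N)%N -> (m <= s N)%N.

(** The ratio b is taken above 1/r, for superharmonicity off the path, below 1/mu, so that b^N beats
    s of order mu^N, and below 3/5, so that a = 4/5 works on the path for every r >= 2. Then k and 1
    - c are taken small. *)
Lemma lower_constants : exists b k c : R,
  [/\ 0 < b < 1, b * mu < 1, 0 < k <= 2, (4 / 5)^-1 + (r%:R - 1) * b + k <= r%:R &
      r%:R * b + b^-1 + k <= r%:R + 1] /\
  [/\ 0 < c, c < 1, c + c^-1 <= 2 + k / 2 & 0 < c + c^-1 - 2].
Proof.
have rR : 2 <= r%:R :> R by rewrite ler_nat.
have r0 : 0 < r%:R :> R by lra.
have mu0 : 0 < mu := lt_trans ltr01 mu1.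
pose t : R := Num.min mu^-1 (3 / 5).
have rt : r%:R^-1 < t.
  rewrite /t lt_min ltf_pV2 ?posrE// mur/=.
  by apply: (@le_lt_trans _ _ 2^-1); [rewrite lef_pV2 ?posrE|lra].
pose b : R := (r%:R^-1 + t) / 2.
have rb : r%:R^-1 < b by rewrite /b; lra.
have bt : b < t by rewrite /b; lra.
have ri : 0 < r%:R^-1 :> R by rewrite invr_gt0.
have b0 : 0 < b by lra.
have b35 : b <= 3 / 5 by rewrite (le_trans (ltW bt))// /t ge_min lexx orbT.
have bmu : b < mu^-1 by rewrite (lt_le_trans bt)// /t ge_min lexx.
have bi : b^-1 < r%:R by rewrite -[ltRHS]invrK ltf_pV2 ?posrE.
pose k : R := Num.min (3 / 20) ((1 - b) * (r%:R - b^-1)).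
have b1 : b < 1 by lra.
have k0 : 0 < k by rewrite /k lt_min divr_gt0//= mulr_gt0 ?subr_gt0.
have k1 : k <= 3 / 20 by rewrite /k ge_min lexx.
have k3 : k <= (1 - b) * (r%:R - b^-1) by rewrite /k ge_min lexx orbT.
pose c : R := 1 - k / 4.
have c0 : 0 < c by rewrite /c; lra.
have cE : c + c^-1 - 2 = (1 - c) ^+ 2 / c by field; rewrite gt_eqF.
exists b, k, c; split; split.
- by rewrite b0.
- by rewrite -ltr_pdivlMr// div1r.
- by rewrite k0 (le_trans k1)//; lra.
- have -> : (4 / 5)^-1 = 5 / 4 :> R by field.
  have : (r%:R - 1) * b <= (r%:R - 1) * (3 / 5) by rewrite ler_wpM2l//; lra.
  lra.
- have : b * b^-1 = 1 by rewrite mulfV// gt_eqF.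
  move: k3; lra.
- by [].
- by rewrite /c; lra.
- rewrite -lerBlDl cE ler_pdivrMr// /c.
  have : k * k <= k * (3 / 20) by rewrite ler_pM2l.
  rewrite expr2; lra.
- by rewrite cE divr_gt0// exprn_gt0// /c; lra.
Qed.

(* q.+2 sets are hit; the q.+1 factors t ^+ l beat the number X ^+ l of       *)
(* windows.                                                                   *)
Lemma lower_arith (q l n : nat) (X t D tau eta A CX : R) :
  0 <= D -> 0 <= tau <= A -> 0 <= CX -> 0 < X -> 0 < t < 1 -> (0 < l)%N ->
  0 <= eta <= A * (t ^+ 2) ^+ l -> X * t ^+ q.+1 <= t ->
  (2 * n + 5)%N%:R <= CX * X ^+ l ->
  (2 * n + 5)%N%:R *
    (2 * (q.+2%:R * ((q.+2 * l.+1 + 2 * (q.+2 * l))%N%:R * D * (1 + tau)) *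
     ((q.+2.-1)`!%:R * ((q.+2 * l.+1 + 2 * (q.+2 * l))%N%:R * D * eta) ^+ q.+2.-1)))
  <= CX * (2 * (q.+2%:R * (3 * q.+2%:R * D * (1 + A)) *
     (q.+1`!%:R * (3 * q.+2%:R * D * A / (1 - t)) ^+ q.+1))) * (l.+1%:R * t ^+ l).
Proof.
move=> D0 /andP[tau0 tauA] CX0 X0 /andP[t0 t1] l0 /andP[eta0 etaA] Xt nX.
have A0 : 0 <= A := le_trans tau0 tauA.
set KK := (_ + 2 * _)%N%:R.
have KK0 : 0 <= KK :> R by [].
have KKl : KK <= 3 * q.+2%:R * l.+1%:R :> R.
  by rewrite /KK -!natrM ler_nat hit_count_le.
have lt : l.+1%:R * t ^+ l <= (1 - t)^-1 by apply: natmul_exp_le; rewrite ltW.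
have tl0 : 0 <= t ^+ l by rewrite exprn_ge0 ?ltW.
have H1 : KK * D * (1 + tau) <= 3 * q.+2%:R * D * (1 + A) * l.+1%:R.
  apply: (@le_trans _ _ (3 * q.+2%:R * l.+1%:R * D * (1 + A))).
    apply: ler_pM; rewrite ?mulr_ge0 ?addr_ge0//; first by rewrite ler_wpM2r.
    by rewrite lerD2l.
  by rewrite le_eqVlt; apply/orP; left; apply/eqP; ring.
have H2 : KK * D * eta <= 3 * q.+2%:R * D * A / (1 - t) * t ^+ l.
  apply: (@le_trans _ _ (3 * q.+2%:R * l.+1%:R * D * (A * (t ^+ 2) ^+ l))).
    by apply: ler_pM; rewrite ?mulr_ge0//; rewrite ler_wpM2r.
  have -> : 3 * q.+2%:R * l.+1%:R * D * (A * (t ^+ 2) ^+ l) =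
      3 * q.+2%:R * D * A * t ^+ l * (l.+1%:R * t ^+ l).
    by rewrite exprAC expr2; ring.
  by rewrite [leRHS]mulrAC; apply: ler_wpM2l => //; rewrite !mulr_ge0.
have H3 : (KK * D * eta) ^+ q.+1 <=
    (3 * q.+2%:R * D * A / (1 - t)) ^+ q.+1 * (t ^+ q.+1) ^+ l.
  by rewrite exprAC -exprMn lerXn2r// nnegrE ?mulr_ge0// invr_ge0 subr_ge0 ltW.
set a1 := 3 * q.+2%:R * D * (1 + A) in H1 *.
set a2 := (_ / (1 - t)) ^+ _ in H3 *.
have a10 : 0 <= a1 by rewrite /a1 !mulr_ge0// addr_ge0.
have a20 : 0 <= a2 by rewrite exprn_ge0// !mulr_ge0// invr_ge0 subr_ge0 ltW.
rewrite [q.+2.-1]/=.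
apply: (@le_trans _ _ (CX * X ^+ l * (2 * (q.+2%:R * (a1 * l.+1%:R) *
   (q.+1`!%:R * (a2 * (t ^+ q.+1) ^+ l)))))).
  apply: ler_pM => //.
    by rewrite !mulr_ge0// ?addr_ge0// exprn_ge0// !mulr_ge0.
  rewrite ler_pM2l//; apply: ler_pM => //.
  - by rewrite !mulr_ge0// addr_ge0.
  - by rewrite mulr_ge0// exprn_ge0// !mulr_ge0.
  - by rewrite ler_wpM2l.
  - by rewrite ler_wpM2l.
have -> : CX * X ^+ l * (2 * (q.+2%:R * (a1 * l.+1%:R) *
    (q.+1`!%:R * (a2 * (t ^+ q.+1) ^+ l)))) =
  CX * (2 * (q.+2%:R * a1 * (q.+1`!%:R * a2))) * (l.+1%:R * (X * t ^+ q.+1) ^+ l).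
  by rewrite exprMn; ring.
apply: ler_wpM2l; first by move: a10 a20; generalize a1 a2 => ? ? ? ?; rewrite !mulr_ge0.
apply: ler_wpM2l => //; apply: lerXn2r => //; rewrite nnegrE ?(ltW t0)//.
by rewrite mulr_ge0 ?exprn_ge0 ?(ltW t0) ?(ltW X0).
Qed.

Lemma lower_asymptotics (x1 : R) : 0 < x1 -> exists N0, forall N, (N0 <= N)%N ->
  forall (x : cylinder (tree r N)) n, (n < s N ^ 2)%N ->
  expect (cnb (@tree_adj r N)) n x
    (fun p => `[< exists k, disconnects (@tree_adj r N) [set` take k p] >]%:R) <= x1.
Proof.
move=> x10.
have [b [k [c [[/andP[b0 b1] bmu /andP[k0 k2] h1 h2] [c0 c1 hc hc0]]]]] := lower_constants.
have mu0 : 0 < mu := lt_trans ltr01 mu1.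
have bm0 : 0 <= b * mu by rewrite mulr_ge0 ?ltW.
(* At scale l = N / K the leaf term is of order (b^(K - 1) mu^K)^l = z^l, and z < 1 once (b mu)^K <=
   b / 2. *)
have [K' HK'] := @exp_le_eventually R (b * mu) (b / 2) (introT andP (conj bm0 bmu))
  (divr_gt0 b0 (ltr0n _ 2)).
pose K := K'.+2.
pose z := b ^+ K'.+1 * mu ^+ K.
have z1 : z < 1.
  have H : (b * mu) ^+ K <= b / 2 by apply: HK'; rewrite /K -addn2 leq_addr.
  rewrite exprMn exprS -/K in H.
  have : b * z <= b / 2 by rewrite /z mulrA.
  by rewrite ler_pM2l// => /le_lt_trans; apply; lra.
have z0 : 0 < z by rewrite mulr_gt0// exprn_gt0.
pose th := Num.max b (Num.max c z).
have th1 : th < 1 by rewrite /th !gt_max b1 c1 z1.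
have bth : b <= th by rewrite /th le_max lexx.
have cth : c <= th by rewrite /th !le_max lexx orbT.
have zth : z <= th by rewrite /th !le_max lexx !orbT.
have th0 : 0 < th := lt_le_trans b0 bth.
(* Each pairwise bound is of order th^l = (t^2)^l; one factor t^l is given up to absorb the
   polynomial factor l + 1. The second square root u serves the same purpose at the end. *)
pose t := Num.sqrt th; have t0 : 0 < t by rewrite sqrtr_gt0.
have t1 : t < 1 by rewrite -sqrtr1 ltr_sqrt.
have tE : th = t ^+ 2 by rewrite sqr_sqrtr// ltW.
pose u := Num.sqrt t; have u0 : 0 < u by rewrite sqrtr_gt0.
have u1 : u < 1 by rewrite -sqrtr1 ltr_sqrt.
have uE : t = u ^+ 2 by rewrite sqr_sqrtr// ltW.
(* X^l is the order of s^2, hence of the number of windows. It depends on K only, so q can be chosen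
   afterwards. *)
pose X := mu ^+ (2 * K); have X0 : 0 < X by rewrite exprn_gt0.
have [q Hq] : exists q, X * t ^+ q.+1 <= t.
  have t01 : 0 <= t < 1 by rewrite ltW.
  have Xi : 0 < X^-1 by rewrite invr_gt0.
  have [q Hq] := exp_le_eventually t01 Xi; exists q.
  rewrite exprS mulrCA ler_piMr ?(ltW t0)// mulrC -ler_pdivlMr// div1r.
  exact: Hq.
pose B := 2 / (c + c^-1 - 2).
have BE : B * (c + c^-1 - 2) = 2 by rewrite /B mulfVK// gt_eqF.
have B0 : 0 <= B by rewrite /B divr_ge0// ltW.
pose D := 2 * (r.+3)%:R / k * expR 2.
have D0 : 0 <= D by rewrite /D mulr_ge0 ?expR_ge0// divr_ge0// ltW.
have B1 : 0 <= 1 + 2 * B by rewrite addr_ge0// mulr_ge0.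
pose C1 := b ^- q.+2 / b * (C * mu ^+ K) * (1 + 2 * B).
have C10 : 0 <= C1.
  have bq0 : 0 <= b ^- q.+2 / b by rewrite divr_ge0 ?invr_ge0 ?exprn_ge0 ?(ltW b0).
  have muK0 : 0 <= C * mu ^+ K by rewrite mulr_ge0 ?exprn_ge0 ?(ltW C0) ?(ltW mu0).
  by apply: mulr_ge0 => //; apply: mulr_ge0.
pose CX := 5 * C ^+ 2 * X; have CX0 : 0 <= CX.
  by apply: mulr_ge0 (ltW X0); rewrite mulr_ge0 ?exprn_ge0 ?(ltW C0).
pose A := 1 + C1.
pose G := CX * (2 * (q.+2%:R * (3 * q.+2%:R * D * (1 + A)) *
   (q.+1`!%:R * (3 * q.+2%:R * D * A / (1 - t)) ^+ q.+1))).
have A0 : 0 <= A by rewrite addr_ge0.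
have G0 : 0 <= G.
  have q0 : 0 <= 3 * q.+2%:R * D by rewrite mulr_ge0.
  rewrite /G; do ![apply: mulr_ge0 => //]; first exact: addr_ge0.
  by rewrite exprn_ge0// divr_ge0 ?subr_ge0 ?(ltW t1)// mulr_ge0.
have u01 : 0 <= u < 1 by rewrite ltW.
have xG : 0 < x1 * (1 - u) / (G + 1) by rewrite divr_gt0 ?mulr_gt0 ?subr_gt0// ltr_wpDl.
have [l1 Hl1] := exp_le_eventually u01 xG.
have c10 : 0 < 1 - c by rewrite subr_gt0.
(* Large enough for the side conditions of [green_bound]: s >= 2, c <= 1 - 1/s and 4 / s^2 <= c +
   1/c - 2. *)
pose s0 := (Num.truncn (1 - c)^-1 + Num.truncn (4 / (c + c^-1 - 2)) + 4)%N.
have [N1 HN1] := s_large s0.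
exists (maxn N1 (K * (l1 + q.+3)))%N => N; rewrite geq_max => /andP[NN1 NK] x n ns.
pose l := (N %/ K)%N.
have [lq qlN NK' lN] := depth_split (erefl l) NK.
have l0 : (0 < l)%N by apply: leq_trans lq; rewrite addnS.
have ss := HN1 N NN1.
have s2 : (2 <= s N)%N by apply: leq_trans ss; rewrite /s0 addnC.
have sR : s0%:R <= (s N)%:R :> R by rewrite ler_nat.
have sN0 : 0 < (s N)%:R :> R by rewrite ltr0n (leq_trans _ s2).
have cs : c <= 1 - (s N)%:R^-1.
  rewrite lerBrDr addrC -lerBrDr -[leRHS]invrK lef_pV2 ?posrE ?invr_gt0//.
  apply: le_trans sR; by rewrite ltW// (lt_le_trans (truncnS_gt _))// ler_nat /s0 -addnA -addn1 leq_add2l addnC.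
have hs : 4 / (s N)%:R ^+ 2 <= c + c^-1 - 2.
  rewrite ler_pdivrMr ?exprn_gt0// mulrC -ler_pdivrMr//.
  apply: (@le_trans _ _ (s N)%:R); last by rewrite expr2 ler_peMr ?(ltW sN0)// ler1n (ltn_trans _ s2).
  apply: le_trans sR; by rewrite ltW// (lt_le_trans (truncnS_gt _))// ler_nat /s0 -addnA addnCA -addn1 leq_add2l addnC.
pose tau := b ^+ (N - (q.+2 + l)) / b * ((s N)%:R * (1 + 2 * B)).
have tau0 : 0 <= tau.
  by rewrite /tau !mulr_ge0 ?invr_ge0 ?exprn_ge0 ?(ltW b0)// addr_ge0// mulr_ge0.
have muN : mu ^+ N <= mu ^+ K * (mu ^+ K) ^+ l.
  by rewrite -exprM -exprD ler_weXn2l ?(ltW mu1).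
have sC : (s N)%:R <= C * mu ^+ K * (mu ^+ K) ^+ l.
  by apply: le_trans (s_le N) _; rewrite -mulrA ler_pM2l.
have tauC : tau <= C1 * z ^+ l.
  have bq : b ^+ (N - (q.+2 + l)) <= b ^- q.+2 * (b ^+ K'.+1) ^+ l.
    by rewrite mulrC ler_pdivlMr ?exprn_gt0// -exprD -exprM ler_wiXn2l ?(ltW b0) ?(ltW b1).
  rewrite /tau /C1 /z exprMn.
  apply: (@le_trans _ _ (b ^- q.+2 * (b ^+ K'.+1) ^+ l / b *
     (C * mu ^+ K * (mu ^+ K) ^+ l * (1 + 2 * B)))); last first.
    by rewrite le_eqVlt; apply/orP; left; apply/eqP; ring.
  apply: ler_pM.
  - by rewrite mulr_ge0 ?invr_ge0 ?exprn_ge0 ?(ltW b0).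
  - by rewrite mulr_ge0// addr_ge0// mulr_ge0.
  - by rewrite ler_wpM2r ?invr_ge0 ?(ltW b0).
  - by rewrite ler_wpM2r// addr_ge0// mulr_ge0.
have tauth : tau <= C1 * th ^+ l.
  by apply: (le_trans tauC); rewrite ler_wpM2l// lerXn2r ?nnegrE ?(ltW z0) ?(ltW th0).
pose eta := A * th ^+ l.
have eta1 : c ^+ l + tau <= eta.
  rewrite /eta /A mulrDl mul1r lerD//.
  by rewrite lerXn2r ?nnegrE ?(ltW c0) ?(ltW th0).
have eta2 : b ^+ l + tau <= eta.
  rewrite /eta /A mulrDl mul1r lerD//.
  by rewrite lerXn2r ?nnegrE ?(ltW b0) ?(ltW th0).
have o01 : Ordinal (ltnW r2) != Ordinal r2 by [].
have a0 : 0 < 4 / 5 :> R by [].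
have a1 : 4 / 5 <= 1 :> R by rewrite ler_pdivrMr// mul1r ler_nat.
have gb f v y : (size (bseqval f) <= q.+2 + l)%N -> green (cnb (@tree_adj r N))
    (fun w => (w == (f, v))%:R) n y <=
    D * (tree_weight (4 / 5) b f y.1 * hat c v y.2 + tau).
  move=> fd; exact: (green_bound a0 a1 b0 (ltW b1) k0 k2 h1 h2 c0 c1 hc v fd qlN y s2 cs BE B0 hs ns).
have := disconnection_prob_le o01 qlN (ltn0Sn _) l0 l0 a0 a1 b0 (ltW b1) c0 c1 D0 tau0 gb eta1 eta2 x.
move/le_trans; apply.
have tauA : 0 <= tau <= A.
  rewrite tau0 (le_trans tauth)// /A -[leLHS]add0r lerD// ler_piMr//.
  by rewrite exprn_ile1 ?ltW.
have etaA : 0 <= eta <= A * (t ^+ 2) ^+ l.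
  by rewrite /eta tE lexx mulr_ge0// !exprn_ge0// ltW.
have nX : (2 * n + 5)%N%:R <= CX * X ^+ l.
  apply: (@le_trans _ _ (5 * (s N)%:R ^+ 2)).
    rewrite -natrX -natrM ler_nat.
    have s4 : (2 ^ 2 <= s N ^ 2)%N by rewrite leq_sqr.
    by move: ns s4; set S := (s N ^ 2)%N; clear; lia.
  have -> : CX * X ^+ l = 5 * (C * mu ^+ K * (mu ^+ K) ^+ l) ^+ 2.
    by rewrite /CX /X [(2 * K)%N]mulnC exprM [(_ ^+ 2) ^+ l]exprAC; ring.
  rewrite ler_pM2l// lerXn2r ?nnegrE//.
  have muK' : 0 <= mu ^+ K by rewrite exprn_ge0 ?(ltW mu0).
  by apply: mulr_ge0; [apply: mulr_ge0 (ltW C0) muK'|apply: exprn_ge0].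
have t01 : 0 < t < 1 by rewrite t0.
apply: (le_trans (lower_arith D0 tauA CX0 X0 t01 l0 etaA Hq nX)).
rewrite -/G.
have Hu : l.+1%:R * t ^+ l <= (1 - u)^-1 * u ^+ l.
  rewrite uE -exprM mul2n -addnn exprD mulrA ler_wpM2r ?exprn_ge0 ?(ltW u0)//.
  exact: natmul_exp_le.
have ul : u ^+ l <= x1 * (1 - u) / (G + 1).
  by apply: Hl1; apply: leq_trans lq; rewrite leq_addr.
apply: (@le_trans _ _ ((G + 1) * ((1 - u)^-1 * u ^+ l))).
  apply: ler_pM => //; first by rewrite mulr_ge0// exprn_ge0// ltW.
  by rewrite lerDl.
have G1 : 0 < G + 1 by rewrite ltr_wpDl.
have u2 : 0 < 1 - u by rewrite subr_gt0.
have -> : x1 = (G + 1) * ((1 - u)^-1 * (x1 * (1 - u) / (G + 1))).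
  by field; rewrite !gt_eqF.
by rewrite ler_pM2l// ler_pM2l ?invr_gt0.
Qed.

End LowerAsymptotics.

Lemma bernoulli_le (R : realType) (h : R) n : 0 <= h -> 1 + n%:R * h <= (1 + h) ^+ n.
Proof.
move=> h0; elim: n => [|n IHn]; first by rewrite mul0r addr0 expr0.
rewrite exprS -natr1; have n0 : 0 <= n%:R * h * h :> R by rewrite !mulr_ge0.
have : (1 + h) * (1 + n%:R * h) <= (1 + h) * (1 + h) ^+ n.
  by rewrite ler_wpM2l// addr_ge0.
by lra.
Qed.

Lemma card_tree_sqr_le (r N : nat) : (2 <= r)%N ->
  (#|{: tree r N}| ^ 2 <= 2 ^ (r * N.+1 * 2))%N.
Proof.
move=> r2; rewrite [(2 ^ _)%N]expnM leq_sqr expnM.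
apply: leq_trans (card_tree_le N r2) _.
by apply: leq_trans (_ : (r ^ N.+1 <= _)%N); [rewrite expnS leq_mul2r r2 orbT|
  rewrite leq_exp2r// ltnW// ltn_expl].
Qed.

(** * Number of visits and time needed to cover a level *)

Section UpperAsymptotics.
Variables (R : realType) (r : nat).
Hypothesis r2 : (2 <= r)%N.

(** The exponent is 2M times 2r(N + 1). By Bernoulli every 2M visits gain a factor 2, and 2^(2r(N +
    1)) >= |G|^2, which leaves 2 / |G|. *)
Lemma visit_exp_le N : (0 < N)%N ->
  #|{: tree r N}|%:R * (2 / (1 + (2 * visit_bound R r N)^-1) ^+
     ((2 * (2 * N * (r.+3 * #|{: tree r N}|))) * (r * N.+1 * 2))%N) <=
  2 / 2 ^+ N :> R.
Proof.
move=> N0; set g := #|{: tree r N}|; set M := visit_bound R r N.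
have gN : (2 ^ N <= g)%N by apply: leq_trans (card_tree_ge r N); rewrite leq_exp2r.
have g0 : 0 < g%:R :> R by rewrite ltr0n (leq_trans _ gN)// expn_gt0.
have M0 : 0 < M := lt_le_trans ltr01 (visit_bound_ge1 R r N0).
set h := (2 * M)^-1; have h0 : 0 < h by rewrite invr_gt0 mulr_gt0.
have H2 : 2 <= (1 + h) ^+ (2 * (2 * N * (r.+3 * g))).
  apply: le_trans (bernoulli_le _ (ltW h0)).
  rewrite natrM -/M [_%:R * M]/(2 * M) mulfV//.
  by rewrite gt_eqF// mulr_gt0.
have Hg : g%:R ^+ 2 <= ((1 + h) ^+ (2 * (2 * N * (r.+3 * g)))) ^+ (r * N.+1 * 2).
  apply: (@le_trans _ _ (2 ^+ (r * N.+1 * 2))).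
    by rewrite -!natrX ler_nat card_tree_sqr_le.
  apply: lerXn2r => //; rewrite nnegrE ?ler0n//.
  exact: le_trans (ler0n _ _) H2.
rewrite exprM; set Y := _ ^+ (r * _ * _) in Hg *.
have Y0 : 0 < Y by apply: lt_le_trans Hg; rewrite exprn_gt0.
apply: (@le_trans _ _ (g%:R * (2 / g%:R ^+ 2))).
  rewrite !ler_pM2l// lef_pV2 ?posrE//.
  exact: exprn_gt0.
have -> : g%:R * (2 / g%:R ^+ 2) = 2 / g%:R :> R by field; rewrite gt_eqF.
by rewrite ler_pM2l// lef_pV2 ?posrE ?exprn_gt0// -natrX ler_nat.
Qed.

(** Since (1 - l)(1 + l) <= 1, Bernoulli's lower bound for (1 + l)^n becomes an upper bound for (1 -
    l)^n. *)
Lemma level_rate_exp_le (s n : nat) (A : R) : (0 < s)%N -> 0 < A ->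
  A * ((r.+4)%:R * s%:R ^+ 2) <= n%:R ->
  (1 - level_rate R r s) ^+ n <= A^-1.
Proof.
move=> s0 A0 An; set l := level_rate R r s.
have d1 : 1 <= (r.+4)%:R * s%:R ^+ 2 :> R by rewrite -natrX -natrM ler1n muln_gt0 expn_gt0 s0.
have d0 : 0 < (r.+4)%:R * s%:R ^+ 2 :> R := lt_le_trans ltr01 d1.
have l0 : 0 < l by rewrite invr_gt0.
have l1 : l <= 1 by rewrite invf_le1.
have H : (1 - l) ^+ n * (1 + l) ^+ n <= 1.
  rewrite -exprMn exprn_ile1//; first by rewrite mulr_ge0 ?subr_ge0// addr_ge0// ltW.
  have : 0 <= l * l by rewrite mulr_ge0 ?ltW.
  by lra.
have Al : A <= (1 + l) ^+ n.
  apply: le_trans (bernoulli_le n (ltW l0)).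
  have : A <= n%:R * l by rewrite /l /level_rate ler_pdivlMr.
  by lra.
rewrite -[leRHS]mul1r ler_pdivlMr//; apply: le_trans H.
by rewrite ler_wpM2l// exprn_ge0// subr_ge0.
Qed.

(** As ln |G| >= N ln 2, four powers of the logarithm give N^4 up to a constant, and the remaining
    power e eventually exceeds any constant. *)
Lemma log_power_large (e Q : R) : 0 < e -> exists N0, forall N, (N0 <= N)%N ->
  Q * N%:R ^+ 4 <= ln (#|{: tree r N}|%:R : R) `^ (4 + e).
Proof.
move=> e0; pose c : R := ln 2.
have c0 : 0 < c by apply: ln_gt0; rewrite ltr1n.
pose Q' := `|Q| / c ^+ 4; have Q0 : 0 <= Q' by rewrite divr_ge0// exprn_ge0// ltW.
exists (Num.truncn (Q' `^ e^-1 / c)).+1 => N HN.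
set L := ln _.
have gN : N%:R * c <= L.
  rewrite /L /c mulr_natl -lnXn// ler_ln ?posrE ?exprn_gt0//.
    rewrite -natrX ler_nat; apply: leq_trans (card_tree_ge r N).
    by case: (N) => [//|N']; rewrite leq_exp2r.
  by rewrite ltr0n card_tree_gt0.
have L0 : 0 <= L by apply: le_trans gN; rewrite mulr_ge0// ltW.
have L1 : 0 < L.
  by apply: lt_le_trans gN; rewrite mulr_gt0// ltr0n (leq_trans _ HN).
have LQ : Q' `^ e^-1 <= L.
  apply: le_trans gN; rewrite -ler_pdivrMr//.
  by rewrite ltW// (lt_le_trans (truncnS_gt _))// ler_nat.
have LeQ : Q' <= L `^ e.
  rewrite -[leLHS](powRr1 Q0) -[1](mulVf (lt0r_neq0 e0)) powRrM.
  by apply: ge0_ler_powR; rewrite ?nnegrE ?powR_ge0 ?(ltW e0).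
rewrite powRD; last by rewrite (gt_eqF L1) implybT.
rewrite powR_mulrn//.
apply: (@le_trans _ _ ((N%:R * c) ^+ 4 * Q')); last first.
  apply: ler_pM => //; first by rewrite exprn_ge0// mulr_ge0// ltW.
  by rewrite lerXn2r ?nnegrE// mulr_ge0// ltW.
have -> : (N%:R * c) ^+ 4 * Q' = `|Q| * N%:R ^+ 4.
  by rewrite /Q' exprMn; field; rewrite gt_eqF.
by rewrite ler_wpM2r ?exprn_ge0// ler_norm.
Qed.

Lemma upper_asymptotics (e x1 : R) : 0 < e -> 0 < x1 -> exists N0, forall N, (N0 <= N)%N ->
  forall (x : cylinder (tree r N)) n,
  #|{: tree r N}|%:R ^+ 2 * ln (#|{: tree r N}|%:R) `^ (4 + e) - 1 <= n%:R ->
  expect (cnb (@tree_adj r N)) n x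
    (fun p => `[< ~ forall h, (h, x.2) \in p >]%:R) <= x1.
Proof.
move=> e0 x0; have x3 : 0 < x1 / 3 by rewrite divr_gt0.
(* W makes s = W N^2 |G| large enough for 2m / s <= x1 / 3, and Q makes n large enough for the
   discount term. The + 1 in Q pays for the - 1 in the bound on n, which comes from rounding a real
   time down. *)
pose W := (Num.truncn ((32 * r * r.+3)%N%:R / (x1 / 3))).+1.
pose Q : R := (x1 / 3)^-1 * ((r.+4)%:R * W%:R ^+ 2) + 1.
have [N1 HN1] := log_power_large Q e0.
have [N2 HN2] : exists N2, forall N, (N2 <= N)%N -> 2 / 2 ^+ N <= x1 / 3.
  have h : 0 <= (2^-1 : R) < 1 by rewrite invr_ge0 ler0n invf_lt1// ltr1n.
  have x6 : 0 < x1 / 3 / 2 by rewrite divr_gt0.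
  have [m Hm] := exp_le_eventually h x6; exists m => N /Hm.
  by rewrite exprVn ler_pdivlMr// mulrC.
exists (maxn (maxn N1 N2) 2) => N; rewrite !geq_max => /andP[/andP[NN1 NN2] N2'] x n Hn.
have N0 : (0 < N)%N by apply: leq_trans N2'.
set g := #|{: tree r N}| in Hn *.
have g0 : (0 < g)%N by apply: card_tree_gt0.
pose s := (W * (N ^ 2 * g))%N.
have s4 : (4 <= N ^ 2)%N by rewrite -[4%N]/(2 ^ 2)%N leq_sqr.
have s2 : (2 <= s)%N.
  rewrite /s /W mulSn (leq_trans _ (leq_addr _ _))// (leq_trans _ (leq_pmulr _ g0))//.
  exact: leq_trans s4.
pose m := ((2 * (2 * N * (r.+3 * g))) * (r * N.+1 * 2))%N.
apply: (le_trans (not_cover_prob_le R N0 x n m s2)).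
have -> : x1 = x1 / 3 + x1 / 3 + x1 / 3 by field.
rewrite -/g; apply: lerD; last exact: le_trans (visit_exp_le N0) (HN2 N NN2).
apply: lerD.
  have ms : (2 * m <= 32 * r * r.+3 * (N ^ 2 * g))%N.
    have -> : (2 * m = 16 * r * r.+3 * (N * N.+1 * g))%N by rewrite /m; ring.
    have : (N * N.+1 <= 2 * N ^ 2)%N by rewrite -mulnn mulnCA leq_mul2l mul2n -addnn -addn1 leq_add2l N0 orbT.
    move=> /(leq_mul (leqnn (16 * r * r.+3))) H.
    rewrite mulnA; apply: leq_trans (leq_mul H (leqnn g)) _.
    by rewrite !mulnA leq_mul2r; apply/orP; right; rewrite leq_eqVlt; apply/orP; left; apply/eqP; ring.
  rewrite ler_pdivrMr ?ltr0n ?(leq_trans _ s2)// -natrM.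
  apply: (@le_trans _ _ (32 * r * r.+3 * (N ^ 2 * g))%N%:R); first by rewrite ler_nat.
  rewrite /s natrM [(W * _)%N%:R]natrM mulrA ler_wpM2r// mulrC -ler_pdivrMr//.
  by rewrite ltW// truncnS_gt.
rewrite -[leRHS]invrK; apply: level_rate_exp_le; rewrite ?invr_gt0 ?(leq_trans _ s2)//.
apply: le_trans Hn.
have gR : 1 <= g%:R ^+ 2 :> R by rewrite -natrX ler1n expn_gt0 g0.
have N4 : 1 <= N%:R ^+ 4 :> R by rewrite -natrX ler1n expn_gt0 N0.
have HQ := HN1 N NN1; rewrite -/g in HQ.
rewrite lerBrDr; apply: (@le_trans _ _ (g%:R ^+ 2 * (Q * N%:R ^+ 4))); last first.
  by rewrite ler_pM2l// (lt_le_trans ltr01).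
have -> : (x1 / 3)^-1 * ((r.+4)%:R * s%:R ^+ 2) =
   g%:R ^+ 2 * (((x1 / 3)^-1 * ((r.+4)%:R * W%:R ^+ 2)) * N%:R ^+ 4).
  by rewrite /s !natrM; ring.
set P := (x1 / 3)^-1 * _.
have -> : g%:R ^+ 2 * (Q * N%:R ^+ 4) = g%:R ^+ 2 * (P * N%:R ^+ 4) + g%:R ^+ 2 * N%:R ^+ 4.
  by rewrite /Q -/P; ring.
by rewrite lerD2l mulr_ege1.
Qed.

End UpperAsymptotics.

(** * Disconnection time *)

Section Event.
Variables (R : realType) (r N : nat) (x0 : cylinder (tree r N)).
Variable P : probability (trajectories (tree r N)) R.
Hypothesis hP : is_srw_law (@tree_adj r N) x0 P.
Local Notation e := (@tree_adj r N).
Local Notation T := (cylinder (tree r N)).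
Implicit Types X : nat -> T.

Lemma prefix_set X n : [set X k | k in [set k | (k <= n)%N]] = [set` mkseq X n.+1].
Proof.
apply/seteqP; split => y /=.
  by move=> [k kn <-]; apply/mapP; exists k => //; rewrite mem_iota.
by move=> /mapP[k]; rewrite mem_iota add0n /= ltnS => kn ->; exists k.
Qed.

Lemma disconnection_time_ge X (a : R) :
  (a%:E <= disconnection_time e R X)%E <->
  forall k, disconnects e [set` mkseq X k.+1] -> a <= k%:R.
Proof.
split=> [aT k dk|H].
  rewrite -lee_fin; apply: (le_trans aT); apply: ereal_inf_lbound.
  by exists k => //=; rewrite prefix_set.
apply: le_ereal_inf_tmp => _ [k /= dk <-]; rewrite lee_fin; apply: H.
by rewrite -prefix_set.
Qed.

(** Times are integers: if no k <= b disconnects, the infimum is at least truncn b + 1 > b. *)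
Lemma disconnection_time_le X (b : R) :
  (disconnection_time e R X <= b%:E)%E <->
  exists k, k%:R <= b /\ disconnects e [set` mkseq X k.+1].
Proof.
split=> [Tb|[k [kb dk]]]; last first.
  apply: (@le_trans _ _ (k%:R)%:E); last by rewrite lee_fin.
  by apply: ereal_inf_lbound; exists k => //=; rewrite prefix_set.
apply: contrapT => nk.
have b0 : 0 <= b.
  rewrite -lee_fin; apply: le_trans Tb; apply/disconnection_time_ge => k _.
  exact: ler0n.
suff : ((Num.truncn b).+1%:R%:E <= disconnection_time e R X)%E.
  by move=> /le_trans /(_ Tb); rewrite lee_fin leNgt truncnS_gt.
apply/disconnection_time_ge => k dk; rewrite ler_nat ltnNge; apply/negP => kb.
apply: nk; exists k; split => //; apply: le_trans (_ : (Num.truncn b)%:R <= _).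
  by rewrite ler_nat.
by rewrite truncn_le.
Qed.

Lemma mkseq_take X k n : (k <= n)%N -> take k (mkseq X n) = mkseq X k.
Proof. by move=> kn; rewrite -map_take take_iota (minn_idPl kn). Qed.

Lemma mkseq_cover_disconnects X n :
  (forall h, (h, x0.2) \in mkseq X n) -> disconnects e [set` mkseq X n].
Proof.
move=> cov; apply: (@cover_disconnects r N _ x0.2
  (\max_(y <- mkseq X n) absz y.2)) => // y /= yX.
by rewrite -abszE lez_nat; apply: (leq_bigmax_seq (F := fun y : T => absz y.2)).
Qed.

Lemma measurable_disconnection_time (a b : R) :
  measurable ([set X | (a%:E <= disconnection_time e R X /\
    disconnection_time e R X <= b%:E)%E] : set (trajectories (tree r N))).
Proof.
have -> : [set X | (a%:E <= disconnection_time e R X /\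
    disconnection_time e R X <= b%:E)%E] =
    (\bigcap_k [set X | disconnects e [set` mkseq X k.+1] -> a <= k%:R]) `&`
    (\bigcup_k [set X | k%:R <= b /\ disconnects e [set` mkseq X k.+1]]).
  apply/seteqP; split => X.
    move=> [/disconnection_time_ge Ha /disconnection_time_le[k Hk]]; split.
      by move=> j _; apply: Ha.
    by exists k.
  move=> [Ha [k _ Hk]]; split; first by apply/disconnection_time_ge => j; apply: Ha.
  by apply/disconnection_time_le; exists k.
apply: measurableI.
  apply: bigcap_measurableType => k _.
  exact: (@measurable_prefix r N x0 k.+1 [set p : seq T | disconnects e [set` p] -> a <= k%:R]).
apply: bigcup_measurable => k _.
exact: (@measurable_prefix r N x0 k.+1 [set p : seq T | k%:R <= b /\ disconnects e [set` p]]).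
Qed.

(** The bad event requires a disconnecting prefix by time n1 or a starting level not covered by time
    n2. Without disconnection up to n1 the time is at least n1 + 1, hence the form of the condition
    on a. *)
Lemma disconnection_time_prob (a b : R) (n1 n2 : nat) :
  a <= n1.+1%:R -> n2%:R <= b ->
  ((1 - (expect (cnb e) n1 x0 (fun p => `[< exists k, disconnects e [set` take k p] >]%:R)
       + expect (cnb e) n2 x0 (fun p => `[< ~ forall h, (h, x0.2) \in p >]%:R)))%:E
   <= P [set X | (a%:E <= disconnection_time e R X /\
                  disconnection_time e R X <= b%:E)%E])%E.
Proof.
move=> an1 n2b; set good := [set X | _].
have mgood := measurable_disconnection_time a b.
pose A1 : set (seq T) := [set p : seq T | exists k, disconnects e [set` take k p]].
pose A2 : set (seq T) := [set p : seq T | ~ forall h, (h, x0.2) \in p].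
have m1 := @measurable_prefix r N x0 n1.+1 A1.
have m2 := @measurable_prefix r N x0 n2.+1 A2.
have sub : ~` good `<=` [set X | A1 (mkseq X n1.+1)] `|` [set X | A2 (mkseq X n2.+1)].
  move=> X nX; apply: contrapT => /not_orP[h1 h2]; apply: nX; split.
    apply/disconnection_time_ge => k dk; rewrite leNgt; apply/negP => ka.
    apply: h1; exists k.+1; rewrite mkseq_take//.
    by rewrite -(ltr_nat R) (lt_le_trans ka).
  apply/disconnection_time_le; exists n2; split => //.
  by apply: mkseq_cover_disconnects; apply: contrapT => nc; apply: h2.
have Pbad : (P (~` good) <=
    (expect (cnb e) n1 x0 (fun p => `[< A1 p >]%:R)
       + expect (cnb e) n2 x0 (fun p => `[< A2 p >]%:R))%:E)%E.
  apply: (@le_trans _ _ (P ([set X | A1 (mkseq X n1.+1)] `|` [set X | A2 (mkseq X n2.+1)]))).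
    by apply: le_measure; rewrite ?inE//; [exact: measurableC|exact: measurableU].
  apply: le_trans; first exact: (measureU2 P m1 m2).
  rewrite EFinD.
  by apply: leeD; apply: prob_prefix_le.
move: Pbad; rewrite probability_setC// -(fineK (fin_num_measure P _ mgood)).
rewrite -EFinB !lee_fin => H; rewrite lerBlDr addrC -lerBlDr; exact: H.
Qed.

End Event.

Theorem corollary4p5 (R : realType) (r : nat) (hr : (2 <= r)%N)
    (P : forall N : nat, cylinder (tree r N) ->
           probability (trajectories (tree r N)) R)
    (hP : forall (N : nat) (x : cylinder (tree r N)), (1 <= N)%N ->
            is_srw_law (@tree_adj r N) x (P N x))
    (eps delta : R) (heps : 0 < eps) (hdelta : 0 < delta) :
  (fun N : nat =>
     ereal_inf [set P N x
       [set X |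
         (((#|{: tree r N}|%:R `^ (2 * (1 - delta)))%:E
             <= disconnection_time (@tree_adj r N) R X) /\
          (disconnection_time (@tree_adj r N) R X
             <= (#|{: tree r N}|%:R ^+ 2 *
                 (ln #|{: tree r N}|%:R) `^ (4 + eps))%:E))%E]
       | x in [set: cylinder (tree r N)]])
    @ \oo --> (1%:E : \bar R).
Proof.
(* Capping delta keeps the exponent 1 - d positive, and a smaller d only raises the lower time, as
   |G| >= 1. *)
pose d : R := Num.min delta (1 / 2).
have d0 : 0 < d by rewrite /d lt_min hdelta divr_gt0.
have dd : d <= delta by rewrite /d ge_min lexx.
have d2 : d <= 1 / 2 by rewrite /d ge_min lexx orbT.
have e0 : 0 < 1 - d by lra.
pose mu : R := r%:R `^ (1 - d).
have rR : 2 <= r%:R :> R by rewrite ler_nat.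
have mu1 : 1 < mu.
  rewrite -[ltLHS](_ : 1 `^ (1 - d) = 1); last by rewrite powR1.
  apply: gt0_ltr_powR; rewrite ?nnegrE//.
  by apply: lt_le_trans rR; rewrite ltr1n.
have mur : mu < r%:R.
  rewrite /mu -[ltRHS]powRr1// /powR ifF ?gt_eqF ?ifF//; try by apply: lt_le_trans rR.
  rewrite ltr_expR ltr_pM2r ?ln_gt0//; first by lra.
  by apply: lt_le_trans rR; rewrite ltr1n.
pose g N : R := #|{: tree r N}|%:R.
have g1 N : 1 <= g N by rewrite ler1n card_tree_gt0.
(* The walk is controlled up to time s^2 - 1, with s^2 >= |G|^(2 (1 - d)). *)
pose s N := (Num.truncn (g N `^ (1 - d))).+2.
have muN N : mu ^+ N = (r%:R ^+ N) `^ (1 - d).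
  by rewrite -(powR_mulrn N (powR_ge0 _ _)) -(powR_mulrn N (ler0n R r)) powRAC.
have s_ge N : g N `^ (1 - d) <= (s N)%:R.
  by apply: ltW; apply: lt_le_trans (truncnS_gt _) _; rewrite ler_nat.
(* Here 4 = 2 + 2: one 2 comes from |G| <= 2 r^N, the other from the rounding, since 1 <= mu^N. *)
have s_le N : (s N)%:R <= 4 * mu ^+ N.
  have h1 : g N `^ (1 - d) <= 2 * mu ^+ N.
    apply: (@le_trans _ _ ((2 * r%:R ^+ N) `^ (1 - d))).
      apply: ge0_ler_powR; rewrite ?nnegrE ?(ltW e0) ?mulr_ge0 ?exprn_ge0//.
      by rewrite -natrX -natrM ler_nat card_tree_le.
    rewrite powRM ?exprn_ge0// -muN ler_wpM2r ?exprn_ge0 ?powR_ge0//.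
    by apply: ler1_powR; [rewrite ler1n|lra].
  have h2 : 1 <= mu ^+ N by rewrite exprn_ege1// ltW.
  rewrite /s -addn2 natrD.
  have : (Num.truncn (g N `^ (1 - d)))%:R <= g N `^ (1 - d) by rewrite truncn_le powR_ge0.
  by move: h1 h2; lra.
have s_large m : exists N0, forall N, (N0 <= N)%N -> (m <= s N)%N.
  have [N0 H] := @exp_ge_eventually R mu m%:R mu1; exists N0 => N /H mN.
  rewrite -(ler_nat R); apply: (le_trans mN); apply: le_trans (s_ge N).
  rewrite muN; apply: ge0_ler_powR; rewrite ?nnegrE ?exprn_ge0 ?(ltW e0)//.
  by rewrite -natrX ler_nat card_tree_ge.
set F := fun N => _.
have F1 N : (F N <= 1%:E)%E.
  apply: le_trans; first by apply: ereal_inf_lbound; exists (tree_root r N, 0).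
  by apply: probability_le1; apply: measurable_disconnection_time (tree_root r N, 0) _ _.
have FN (eta : R) : 0 < eta -> \forall N \near \oo, ((1 - eta)%:E <= F N)%E.
  move=> eta0; have eta2 : 0 < eta / 2 by rewrite divr_gt0.
  have [N1 H1] := lower_asymptotics hr mu1 mur (ltr0n _ 4) s_le s_large eta2.
  have [N2 H2] := upper_asymptotics hr heps eta2.
  exists (maxn (maxn N1 N2) 1) => // N /=; rewrite !geq_max => /andP[/andP[NN1 NN2] N0].
  apply: le_ereal_inf_tmp => _ [x _ <-].
  set b := g N ^+ 2 * ln (g N) `^ (4 + eps).
  have b0 : 0 <= b by rewrite mulr_ge0 ?exprn_ge0 ?powR_ge0// (le_trans ler01).
  have s0 : (0 < s N ^ 2)%N by rewrite expn_gt0.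
  have a1 : g N `^ (2 * (1 - delta)) <= ((s N ^ 2).-1.+1)%:R.
    rewrite prednK//; apply: (@le_trans _ _ (g N `^ (2 * (1 - d)))).
      by apply: ler_powR => //; lra.
    rewrite mulrC powRrM -[2]/(2%:R) powR_mulrn ?powR_ge0// natrX.
    by rewrite lerXn2r ?nnegrE ?powR_ge0.
  have b1 : (Num.truncn b)%:R <= b by rewrite truncn_le.
  have nN : ((s N ^ 2).-1 < s N ^ 2)%N by rewrite prednK.
  have bn : b - 1 <= (Num.truncn b)%:R.
    by rewrite lerBlDr natr1 ltW// truncnS_gt.
  apply: le_trans (disconnection_time_prob (hP N x N0) a1 b1).
  rewrite lee_fin; have := H1 N NN1 x _ nN; have := H2 N NN2 x _ bn.
  by lra.
apply/fine_cvgP; split.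
  near=> N; rewrite fin_numElt; apply/andP; split.
    apply: (@lt_le_trans _ _ (1 - 1)%:E); first by rewrite ltNyr.
    by near: N; apply: FN.
  apply: (@le_lt_trans _ _ 1%:E); last by rewrite ltry.
  exact: F1.
apply/cvgrPdist_le => eta eta0; near=> N.
have l1 : ((1 - eta)%:E <= F N)%E by near: N; apply: FN.
have l2 := F1 N.
rewrite /=; case: (F N) l1 l2 => [f| |]//; rewrite !lee_fin /= => l1 l2.
by rewrite ler_distlC; apply/andP; split; lra.
Unshelve. all: by end_near.
Qed.
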